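(* Let $\mathcal{X}=\mathbb{R}^d$. Let $\widehat P_X,\widehat P'_X$ be empirical distributions of points $X_1,\dots,X_{n_1}$ and $X'_1,\dots,X'_{n_2}$ in $\mathbb{R}^d$, let $x,x'\in\mathbb{R}^d$, $\tilde x=(\widehat P_X,x)$, $\tilde x'=(\widehat P'_X,x')$. Let $k'_X(x,y)=\exp(-\|x-y\|^2/(2\sigma'^2))$, $\Psi(\widehat P)=\frac1{|\widehat P|}\sum_i k'_X(X_i,\cdot)$ its kernel mean embedding, and $$\bar k(\tilde x,\tilde x')=\exp\Big(-\frac{\|\Psi(\widehat P_X)-\Psi(\widehat P'_X)\|^2_{\mathcal{H}_{k'_X}}}{2\sigma_P^2}\Big)\exp\Big(-\frac{\|x-x'\|^2}{2\sigma_X^2}\Big).$$ Draw $w_1,\dots,w_L$ i.i.d. from $N(0,\sigma'^{-2}I_d)$ and set $Z_P(\widehat P_X)=\frac{1}{n_1\sqrt L}\sum_{i=1}^{n_1}[\cos(w_1^TX_i),\sin(w_1^TX_i),\dots,\cos(w_L^TX_i),\sin(w_L^TX_i)]\in\mathbb{R}^{2L}$ (and analogously $Z_P(\widehat P'_X)$ with $n_2$, $X'_j$). Let $u=(\sigma_XZ_P(\widehat P_X),\sigma_Px)$, $u'=(\sigma_XZ_P(\widehat P'_X),\sigma_Px')\in\mathbb{R}^{2L+d}$; draw $v_1,\dots,v_Q$ i.i.d. (independently of the $w_l$) from $N(0,(\sigma_P\sigma_X)^{-2}I_{2L+d})$, and let $\bar z(\tilde x)=\frac1{\sqrt Q}[\cos(v_1^Tu),\sin(v_1^Tu),\dots,\cos(v_Q^Tu),\sin(v_Q^Tu)]$,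 $\bar z(\tilde x')$ analogously with $u'$. Then for any $\epsilon_l>0,\epsilon_q>0$, $$P\big(|\bar k(\tilde x,\tilde x')-\bar z(\tilde x)^T\bar z(\tilde x')|\ge\epsilon_l+\epsilon_q\big)\le 2\exp\Big(-\frac{Q\epsilon_q^2}{2}\Big)+6n_1n_2\exp\Big(-\frac{L\epsilon^2}{2}\Big),$$ where $\epsilon=\frac{\sigma_P^2}{2}\log(1+\epsilon_l)$ and the probability is over the random features $w_l,v_q$.
   Context: $N(0,\Sigma)$ is the centred Gaussian; these are the spectral (Fourier) distributions of the Gaussian kernels $\exp(-\|x-y\|^2/(2s^2))$ with $s=\sigma'$ and $s=\sigma_P\sigma_X$ respectively (random Fourier features). $\|\Psi(\widehat P)-\Psi(\widehat P')\|^2$ is computed via $\langle\Psi(\widehat P),\Psi(\widehat P')\rangle=\frac1{n_1n_2}\sum_{i,j}k'_X(X_i,X'_j)$. *)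

(* Defs.v *)
From HB Require Import structures.
From mathcomp Require Import all_boot all_order all_algebra.
From mathcomp Require Import all_classical all_reals all_analysis.
Set Implicit Arguments. Unset Strict Implicit. Unset Printing Implicit Defensive.
Import Order.TTheory GRing.Theory Num.Theory.
Local Open Scope classical_set_scope.
Local Open Scope ring_scope.

Definition dotv (R : realType) (n : nat) (a b : 'I_n -> R) : R :=
  \sum_(i < n) a i * b i.

Definition sqdist (R : realType) (n : nat) (a b : 'I_n -> R) : R :=
  dotv (fun i => a i - b i) (fun i => a i - b i).

Definition gauss_kernel (R : realType) (n : nat) (s : R) (a b : 'I_n -> R) : R :=
  expR (- sqdist a b / (2 * s ^+ 2)).

(* ||Psi(P) - Psi(P')||^2 in the RKHS of k'_X = gauss_kernel s', computed via
   <Psi(P),Psi(P')> = 1/(n1 n2) sum_{i,j} k'_X(X_i, X'_j). *)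
Definition mmd2 (R : realType) (d n1 n2 : nat) (s : R)
    (X : 'I_n1 -> 'I_d -> R) (X' : 'I_n2 -> 'I_d -> R) : R :=
  (\sum_(i < n1) \sum_(j < n1) gauss_kernel s (X i) (X j)) / (n1%:R ^+ 2)
  + (\sum_(i < n2) \sum_(j < n2) gauss_kernel s (X' i) (X' j)) / (n2%:R ^+ 2)
  - 2 * (\sum_(i < n1) \sum_(j < n2) gauss_kernel s (X i) (X' j)) / (n1%:R * n2%:R).

Definition kbar (R : realType) (d n1 n2 : nat) (s' sP sX : R)
    (X : 'I_n1 -> 'I_d -> R) (X' : 'I_n2 -> 'I_d -> R) (x x' : 'I_d -> R) : R :=
  expR (- mmd2 s' X X' / (2 * sP ^+ 2)) * expR (- sqdist x x' / (2 * sX ^+ 2)).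

(* index k of a vector of length 2n, written [c_1, s_1, ..., c_n, s_n],
   belongs to block k %/ 2 (0-based); odd k is a sine entry, even k a cosine. *)
Lemma half_ord_proof (n : nat) (k : 'I_(2 * n)) : (k %/ 2 < n)%N.
Proof. by rewrite ltn_divLR // [(n * 2)%N]mulnC ltn_ord. Qed.

Definition half_ord (n : nat) (k : 'I_(2 * n)) : 'I_n := Ordinal (half_ord_proof k).

Definition cos_sin (R : realType) (k : nat) (t : R) : R :=
  if odd k then sin t else cos t.

Definition ZP (R : realType) (d L n : nat) (W : 'I_L -> 'I_d -> R)
    (X : 'I_n -> 'I_d -> R) : 'I_(2 * L) -> R :=
  fun k => (n%:R * Num.sqrt L%:R)^-1 *
           \sum_(i < n) cos_sin k (dotv (W (half_ord k)) (X i)).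

Definition uvec (R : realType) (d L n : nat) (sP sX : R) (W : 'I_L -> 'I_d -> R)
    (X : 'I_n -> 'I_d -> R) (x : 'I_d -> R) : 'I_(2 * L + d) -> R :=
  fun j => match fintype.split j with
           | inl k => sX * ZP W X k
           | inr i => sP * x i
           end.

Definition zbar (R : realType) (m Q : nat) (V : 'I_Q -> 'I_m -> R)
    (u : 'I_m -> R) : 'I_(2 * Q) -> R :=
  fun k => (Num.sqrt Q%:R)^-1 * cos_sin k (dotv (V (half_ord k)) u).

Definition mutually_independent (dT : measure_display) (T : measurableType dT)
    (R : realType) (P : probability T R) (I : finType) (X : I -> T -> R) : Prop :=
  forall (J : {set I}) (B : I -> set R), (forall i, measurable (B i)) ->
    P (\bigcap_(i in [set i | i \in J]) (X i @^-1` B i)) =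
    (\prod_(i in J) P (X i @^-1` B i))%E.

Definition feature_family (dT : measure_display) (T : measurableType dT)
    (R : realType) (P : probability T R) (d L Q : nat)
    (W : 'I_L -> 'I_d -> {RV P >-> R}) (V : 'I_Q -> 'I_(2 * L + d) -> {RV P >-> R})
    : ('I_L * 'I_d + 'I_Q * 'I_(2 * L + d))%type -> T -> R :=
  fun i => match i with
           | inl (l, k) => (W l k : T -> R)
           | inr (q, j) => (V q j : T -> R)
           end.

(* Main.v *)
(** Let k~(w) be the kernel obtained from kbar by replacing the squared MMD with
    |Z_P - Z_P'|^2; it only depends on the first-layer features w.

    Conditionally on w, zbar^T zbar' is an average of Q independent variables
    cos (v_q . (u - u')) with values in [-1, 1] and mean k~(w), the Gaussian
    characteristic function at u - u', so Hoeffding's inequality controls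
    zbar^T zbar' - k~(w).

    |Z_P - Z_P'|^2 is itself an average of L independent variables
    |phi(w_l) - phi'(w_l)|^2 in [0, 4], where phi and phi' are the empirical
    characteristic functions of the two samples, and its mean is the squared
    MMD.  Hoeffding's inequality for this average, instead of a union bound over
    pairs of points (which would involve n1^2 and n2^2), already gives a bound
    2 exp (- L eps^2 / 2), and kbar is a Lipschitz-like function of the MMD.

    Conditioning is replaced by decoupling: if sigma-algebras F1 and F2 on the
    sample space are independent, then the image of P under the diagonal map is
    P x P on F1 (x) F2, so that the two layers can be evaluated at independent
    sample points.  The Gaussian characteristic function comes from the equation
    A' = - s^2 t A for A(t) = E cos (t X + th). *)

Require Import Defs.
From HB Require Import structures.
From mathcomp Require Import all_boot all_order all_algebra.
From mathcomp Require Import all_classical all_reals all_analysis.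
From mathcomp Require Import measurable_realfun ring lra zify.
Import Order.TTheory GRing.Theory Num.Theory.
Import numFieldNormedType.Exports.
Local Open Scope classical_set_scope.
Local Open Scope ring_scope.
Set Implicit Arguments.
Unset Strict Implicit.
Unset Printing Implicit Defensive.

(** * Calculus for the exponential moment of a two-valued variable *)

Section calculus.
Variable R : realType.
Implicit Types (f df : R -> R) (x m : R).

Lemma is_derive_ge0_le0 f df : (forall x, is_derive x 1 f (df x)) ->
  (forall x, 0 <= x -> 0 <= df x) -> forall x, 0 <= x -> f 0 <= f x.
Proof.
move=> fdf df0 x x0; have cf : {within `[0, x], continuous f}.
  apply: continuous_subspaceT => y.
  by apply/differentiable_continuous/derivable1_diffP; case: (fdf y).
have [c cx /eqP] := MVT_segment x0 (fun y _ => fdf y) cf.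
rewrite subr0 -subr_ge0 => /eqP ->; rewrite mulr_ge0// df0//.
by move: cx; rewrite in_itv/= => /andP[].
Qed.

(** The left-hand side [D x] is the exponential moment of a variable with values 1 and - 1 and mean
    [m]. For x >= 0, h x = x m + x^2 / 2 - ln (D x) vanishes at 0 together with h', and h'' = (D' /
    D)^2 >= 0. The case x < 0 follows by changing the signs of both [x] and [m]. *)
Lemma two_point_mgf_le m x : `|m| <= 1 ->
  (1 + m) / 2 * expR x + (1 - m) / 2 * expR (- x) <= expR (x * m + x ^+ 2 / 2).
Proof.
wlog x0 : m x / 0 <= x => [hw|] m1.
  have [x0|/ltW x0] := leP 0 x; first exact: hw.
  have := hw (- m) (- x); rewrite oppr_ge0 normrN !opprK mulrNN sqrrN.
  by move=> /(_ x0 m1); rewrite addrC.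
have /andP[m1l m1r] : -1 <= m <= 1 by rewrite -ler_norml.
pose D y : R := (1 + m) / 2 * expR y + (1 - m) / 2 * expR (- y).
pose N y : R := (1 + m) / 2 * expR y - (1 - m) / 2 * expR (- y).
have dD (y : R) : is_derive y 1 D (N y).
  by rewrite /D; apply: is_derive_eq; rewrite /N /GRing.scale/=; ring.
have dN (y : R) : is_derive y 1 N (D y).
  by rewrite /N; apply: is_derive_eq; rewrite /D /GRing.scale/=; ring.
have D0 y : 0 < D y.
  have e1 := expR_gt0 y; have e2 := expR_gt0 (- y).
  (* A weight vanishes when [m] is 1 or - 1; the sign of [m] selects one that is certainly
     positive. *)
  have [mle0|m0] := leP m 0; rewrite /D.
    by rewrite ltr_wpDl ?mulr_ge0 ?mulr_gt0//; lra.
  by rewrite ltr_pwDl ?mulr_ge0 ?mulr_gt0//; lra.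
pose r y : R := m + y - N y / D y.
(* As D'' = D, the derivative of N / D is 1 - (N / D)^2. *)
have dr (y : R) : is_derive y 1 r ((N y / D y) ^+ 2).
  have Dy := lt0r_neq0 (D0 y).
  have dDV := is_deriveV Dy (dD y).
  rewrite /r; apply: is_derive_eq; rewrite /GRing.scale/=; field.
  exact: Dy.
have r0 y : 0 <= y -> 0 <= r y.
  move=> y0; have -> : 0 = r 0.
    by rewrite /r /N /D oppr0 expR0; field; rewrite ?pnatr_eq0//; lra.
  exact: (is_derive_ge0_le0 dr (fun z _ => sqr_ge0 _)).
pose h y : R := y * m + y ^+ 2 / 2 - ln (D y).
have dh (y : R) : is_derive y 1 h (r y).
  have dl := is_derive1_comp (is_derive1_ln (D0 y)) (dD y).
  rewrite /h; apply: is_derive_eq; rewrite /r /GRing.scale/=; field.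
  exact: lt0r_neq0.
have : 0 <= h x.
  have -> : 0 = h 0; last exact: (is_derive_ge0_le0 dh r0).
  rewrite /h /D oppr0 expR0 (_ : (1 + m) / 2 * 1 + _ = 1);
    last by field.
  by rewrite ln1; ring.
by rewrite /h subr_ge0 -ler_expR lnK// posrE.
Qed.
End calculus.

(** * The Gaussian characteristic function *)

Lemma integrable_bounded d (T : measurableType d) (R : realType)
    (P : probability T R) (f : T -> R) M : measurable_fun setT f ->
  (forall x, `|f x| <= M) -> P.-integrable setT (EFin \o f).
Proof.
move=> mf fM; apply: measurable_bounded_integrable => //.
  by rewrite [X in (X < _)%E]probability_setT ltry.
exists M; split; first exact: num_real.
by move=> N MN x _; exact: le_trans (ltW MN).
Qed.

Section gaussian_trigonometric.
Variables (R : realType) (s : R).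
Hypothesis s0 : 0 < s.
Local Notation mu := lebesgue_measure.
Local Notation g := (normal_pdf 0 s).

Let sN0 : s != 0 := lt0r_neq0 s0.

Lemma normal_pdf0E x : g x = normal_peak s * expR (- x ^+ 2 / (s ^+ 2 *+ 2)).
Proof. by rewrite normal_pdfE// /normal_fun subr0. Qed.

Lemma is_derive_normal_pdf0 (x : R) : is_derive x 1 g (- x / s ^+ 2 * g x).
Proof.
have -> : g = fun y => normal_peak s * expR (- y ^+ 2 / (s ^+ 2 *+ 2)).
  by apply/funext => y; exact: normal_pdf0E.
have d2 : is_derive x 1 (fun y : R => - y ^+ 2 / (s ^+ 2 *+ 2)) (- x / s ^+ 2).
  by apply: is_derive_eq; rewrite /GRing.scale/=; field.
have dc := is_derive1_comp (is_derive_expR _) d2.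
by apply: is_derive_eq; rewrite /GRing.scale/=; ring.
Qed.

Lemma integral_translation (f : R -> R) h : continuous f -> (forall x, 0 <= f x) ->
  (\int[mu]_x (f x)%:E = \int[mu]_x (f (x + h))%:E)%E.
Proof.
move=> cf f0; have dF (x : R) : is_derive x 1 (fun y : R => y + h) 1.
  by apply: is_derive_eq; rewrite addr0.
have F1 : ((fun y : R => y + h)^`())%classic = cst 1.
  by apply/funext => x; rewrite derive1E; case: (dF x).
rewrite (@increasing_ge0_integration_by_substitutionT R (fun y => y + h))//.
- by apply: eq_integral => x _; rewrite F1 /= !fctE mulr1.
- by move=> x y; rewrite ltrD2r.
- by rewrite F1 => x; exact: cvg_cst.
- by rewrite F1; exact: is_cvg_cst.
- by rewrite F1; exact: is_cvg_cst.
- exact: cvg_addrr_Ny.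
- exact: cvg_addrr.
Qed.

Lemma integrable_bounded_normal_pdf (u : R -> R) : measurable_fun setT u ->
  (forall x, `|u x| <= 1) -> mu.-integrable setT (fun x => (u x * g x)%:E).
Proof.
move=> mu_ u1; apply: (le_integrable _ _ _ (integrable_normal_pdf 0 s)) => //.
  apply/measurable_EFinP; apply: measurable_funM => //.
  exact: measurable_normal_pdf.
move=> x _ /=; rewrite lee_fin normrM.
by rewrite ler_piMl// ger0_norm ?normal_pdf_ge0.
Qed.

Let cg : continuous g := @continuous_normal_pdf R 0 s sN0.

Let continuous_translation (f : R -> R) c :
  continuous f -> continuous (fun x : R => f (x + c)).
Proof.
move=> cf x; apply: (@continuous_comp _ _ _ (fun x => x + c) f); last exact: cf.
by apply: cvgD; [exact: cvg_id|exact: cvg_cst].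
Qed.

Let integrable_translated h : mu.-integrable setT (fun x : R => (g (x + h))%:E).
Proof.
apply/integrableP; split.
  apply/measurable_EFinP; apply: continuous_measurable_fun.
  exact: continuous_translation.
under eq_integral do rewrite gee0_abs ?lee_fin ?normal_pdf_ge0//.
rewrite -(integral_translation h cg (normal_pdf_ge0 0 s)).
by rewrite integral_normal_pdf ltry.
Qed.

Let integrable_bounded_translated (u : R -> R) h : continuous u ->
  (forall x, `|u x| <= 1) -> mu.-integrable setT (fun x => (u x * g (x + h))%:E).
Proof.
move=> cu u1; apply: (le_integrable _ _ _ (integrable_translated h)) => //.
  apply/measurable_EFinP; apply: measurable_funM.
    exact: continuous_measurable_fun.
  by apply: continuous_measurable_fun; exact: continuous_translation.
move=> x _ /=; rewrite lee_fin normrM.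
by rewrite ler_piMl// ger0_norm ?normal_pdf_ge0.
Qed.

(** [integral_translation] is about nonnegative functions, so it is applied to (1 + u (x - h)) g x,
    and the total mass 1 of [g] is then subtracted from both sides. *)
Lemma Rintegral_translation (u : R -> R) h : continuous u -> (forall x, `|u x| <= 1) ->
  \int[mu]_x (u x * g (x + h)) = \int[mu]_x (u (x - h) * g x).
Proof.
move=> cu u1.
have mug (w : R -> R) : continuous w -> (forall x, `|w x| <= 1) ->
    (\int[mu]_x ((1 + w x) * g x)%:E = 1 + \int[mu]_x (w x * g x)%:E)%E.
  move=> cw w1; under eq_integral do rewrite mulrDl mul1r EFinD.
  rewrite integralD//=; first by rewrite integral_normal_pdf.
    exact: integrable_normal_pdf.
  apply: integrable_bounded_normal_pdf => //; exact: continuous_measurable_fun.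
pose v x := u (x - h).
have cv : continuous v by exact: continuous_translation.
have : (\int[mu]_x ((1 + v x) * g x)%:E
        = 1 + \int[mu]_x (u x * g (x + h))%:E)%E.
  rewrite (integral_translation h) => [|x|x].
  - under eq_integral do rewrite /v addrK mulrDl mul1r EFinD.
    rewrite integralD//=; last exact: integrable_bounded_translated.
    congr (_ + _)%E.
    rewrite -(integral_translation h cg (normal_pdf_ge0 0 s)).
    exact: integral_normal_pdf.
  - apply: cvgM; last exact: cg.
    by apply: cvgD; [exact: cvg_cst|exact: cv].
  - rewrite mulr_ge0 ?normal_pdf_ge0//.
    by have := u1 (x - h); rewrite ler_norml /v; lra.
rewrite mug//; last by move=> x; exact: u1.
move=> /(congr1 (fun e => e - 1)%E).
by rewrite ![(1 + _)%E]addeC !addeK// /Rintegral => ->.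
Qed.

(** A multiple of the Gaussian density of standard deviation 2 s dominates, uniformly over
    translations by less than 1. It justifies both differentiations under the integral sign
    below. *)
Lemma normal_pdf0_translation_dominated : exists G : R -> R,
  [/\ forall x, 0 <= G x, mu.-integrable setT (EFin \o G) &
      forall x h, `|h| < 1 -> `|x + h| * g (x + h) <= G x].
Proof.
(* The factor 2 s comes from the bound on |y|, the quotient of the peaks from the change of density,
   and the exponential from x^2 <= 2 y^2 + 2. *)
pose C := 2 * s * normal_peak s * (normal_peak (2 * s))^-1 * expR (s ^- 2 / 4).
have C0 : 0 <= C.
  by rewrite /C !mulr_ge0 ?invr_ge0 ?normal_peak_ge0 ?expR_ge0 ?(ltW s0).
exists (fun x => C * normal_pdf 0 (2 * s) x); split => [x||x h h1].
- by rewrite mulr_ge0// normal_pdf_ge0.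
- exact: (integrableZl measurableT C (integrable_normal_pdf 0 (2 * s))).
rewrite /C.
have s20 : 2 * s != 0 by rewrite mulf_neq0.
have p2 := normal_peak_gt0 s20.
have p1 := normal_peak_gt0 sN0.
rewrite normal_pdf0E (normal_pdfE _ s20) /normal_fun subr0.
set y := x + h.
(* With z = |y| / (2 s), this is z <= 1 + z^2 <= exp (z^2). Half of the Gaussian decay in y absorbs
   the exponential. *)
have yle : `|y| <= 2 * s * expR (y ^+ 2 / (4 * s ^+ 2)).
  have -> : `|y| = 2 * s * (`|y| / (2 * s)) by field.
  rewrite ler_pM2l ?mulr_gt0//; apply: le_trans (expR_ge1Dx _).
  rewrite (_ : y ^+ 2 / (4 * s ^+ 2) = (`|y| / (2 * s)) ^+ 2).
    by have := sqr_ge0 (`|y| / (2 * s) - 1 / 2); nra.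
  by rewrite -(real_normK (num_real y)); field.
rewrite [leRHS](_ : _ = normal_peak s *
    (2 * s * expR (s ^- 2 / 4 + - x ^+ 2 / ((2 * s) ^+ 2 *+ 2)))); last first.
  by rewrite expRD; field; exact: lt0r_neq0.
rewrite [leLHS]mulrCA ler_pM2l//.
apply: (le_trans (ler_wpM2r (expR_ge0 _) yle)).
rewrite -[leLHS]mulrA -expRD ler_pM2l ?mulr_gt0// ler_expR.
rewrite -subr_ge0 [leRHS](_ : _ = (2 + 2 * y ^+ 2 - x ^+ 2) / (8 * s ^+ 2)); last first.
  by rewrite /y; field.
apply: divr_ge0; last by apply: mulr_ge0 => //; exact: sqr_ge0.
rewrite /y.
have : h ^+ 2 <= 1.
  by rewrite -(real_normK (num_real h)) expr_le1// ltW.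
(* 2 (x + h)^2 - x^2 + 2 h^2 = (x + 2 h)^2. *)
by have := sqr_ge0 (x + 2 * h); nra.
Qed.

(** The phase [th] makes sines a special case, through [th - pi / 2], and later lets the remaining
    coordinates of a linear form be absorbed when one coordinate is integrated out. *)
Let A th t := \int[mu]_x (cos (t * x + th) * g x).

Let continuous_phase t th : continuous (fun x : R => t * x + th).
Proof.
move=> x; apply: cvgD; last exact: cvg_cst.
by apply: cvgM; [exact: cvg_cst|exact: cvg_id].
Qed.

Let continuous_cos_phase t th : continuous (fun x : R => cos (t * x + th)).
Proof.
move=> x; apply: (@continuous_comp _ _ _ (fun x => t * x + th) cos).
  exact: continuous_phase.
exact: continuous_cos.
Qed.

Let continuous_sin_phase t th : continuous (fun x : R => sin (t * x + th)).
Proof.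
move=> x; apply: (@continuous_comp _ _ _ (fun x => t * x + th) sin).
  exact: continuous_phase.
exact: continuous_sin.
Qed.

Let integrable_cos_phase t th :
  mu.-integrable setT (fun x => (cos (t * x + th) * g x)%:E).
Proof.
apply: integrable_bounded_normal_pdf.
  exact: continuous_measurable_fun.
by move=> x; exact: cos_max.
Qed.

Let integrable_sin_phase t th :
  mu.-integrable setT (fun x => (sin (t * x + th) * g x)%:E).
Proof.
apply: integrable_bounded_normal_pdf.
  exact: continuous_measurable_fun.
by move=> x; exact: sin_max.
Qed.

(** Differentiation under the integral sign in t; the dominating function is [G] for the zero
    translation. *)
Let dA (th t : R) : is_derive t 1 (A th) (\int[mu]_x (- (x * sin (t * x + th) * g x))).
Proof.
have [G [G0 intG Gub]] := normal_pdf0_translation_dominated.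
pose f r x := cos (r * x + th) * g x.
have df (r x : R) : is_derive r 1 (f ^~ x) (- (x * sin (r * x + th) * g x)).
  have dp : is_derive r 1 (fun y : R => y * x + th) x.
    by apply: is_derive_eq; rewrite /GRing.scale/=; ring.
  have dc := is_derive1_comp (is_derive_cos _) dp.
  by apply: is_derive_eq; rewrite /GRing.scale/=; ring.
have d1f r x : partial1of2 f r x = - (x * sin (r * x + th) * g x).
  by rewrite partial1of2E; case: (df r x).
have It : `]t - 1, t + 1[%classic t by rewrite /= in_itv/=; apply/andP; split; lra.
have d1f_ub r x : `]t - 1, t + 1[%classic r -> setT x -> `|partial1of2 f r x| <= G x.
  move=> _ _; rewrite d1f normrN.
  have := Gub x 0; rewrite normr0 addr0 => /(_ ltr01); apply: le_trans.
  rewrite !normrM (ger0_norm (normal_pdf_ge0 _ _ _)).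
  by rewrite ler_wpM2r ?normal_pdf_ge0// ler_piMr//; exact: sin_max.
have intf r : `]t - 1, t + 1[%classic r -> mu.-integrable setT (EFin \o f r).
  by move=> _; exact: integrable_cos_phase.
have derf r x : `]t - 1, t + 1[%classic r -> setT x -> derivable (f ^~ x) r 1.
  by move=> _ _; case: (df r x).
apply: DeriveDef.
  exact: (derivable_under_integral measurableT It intf derf G0 intG d1f_ub).
rewrite -derive1E.
rewrite (differentiation_under_integral measurableT It intf derf G0 intG d1f_ub).
by apply: eq_Rintegral => x _; exact: d1f.
Qed.

(* Differentiate both sides of
   int sin (t x + th) g (x + r) dx = int sin (t (x - r) + th) g x dx
   in r at r = 0. *)
Let translation_derivative th t :
  \int[mu]_x (- (x * sin (t * x + th) * g x)) = - s ^+ 2 * t * A th t.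
Proof.
have [G [G0 intG Gub]] := normal_pdf0_translation_dominated.
pose f r x := sin (t * x + th) * g (x + r).
have df (r x : R) : is_derive r 1 (f ^~ x)
    (sin (t * x + th) * (- (x + r) / s ^+ 2 * g (x + r))).
  have dp : is_derive r 1 (fun y : R => x + y) 1.
    by apply: is_derive_eq; rewrite /GRing.scale/=; ring.
  have dc := is_derive1_comp (is_derive_normal_pdf0 _) dp.
  by apply: is_derive_eq; rewrite /GRing.scale/=; ring.
have d1f r x : partial1of2 f r x =
    sin (t * x + th) * (- (x + r) / s ^+ 2 * g (x + r)).
  by rewrite partial1of2E; case: (df r x).
have I0 : `](-1 : R), 1[%classic 0 by rewrite /= in_itv/=; apply/andP; split; lra.
pose G' x := s ^- 2 * G x.
have s2 : 0 < s ^- 2 by rewrite invr_gt0 exprn_gt0.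
have G'0 x : 0 <= G' x by rewrite /G' mulr_ge0// ltW.
have intG' : mu.-integrable setT (EFin \o G').
  exact: (integrableZl measurableT (s ^- 2) intG).
have d1f_ub r x : `](-1 : R), 1[%classic r -> setT x -> `|partial1of2 f r x| <= G' x.
  rewrite /= in_itv/= -ltr_norml => r1 _; rewrite d1f.
  rewrite mulrAC mulrA normrM mulrC (gtr0_norm s2) ler_pM2l//.
  have := Gub x r r1; apply: le_trans.
  rewrite !normrM normrN (ger0_norm (normal_pdf_ge0 _ _ _)) ler_piMl//.
    by rewrite mulr_ge0// normal_pdf_ge0.
  exact: sin_max.
have intf r : `](-1 : R), 1[%classic r -> mu.-integrable setT (EFin \o f r).
  by move=> _; apply: integrable_bounded_translated => // x; exact: sin_max.
have derf r x : `](-1 : R), 1[%classic r -> setT x -> derivable (f ^~ x) r 1.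
  by move=> _ _; case: (df r x).
have := differentiation_under_integral measurableT I0 intf derf G'0 intG' d1f_ub.
(* After translation, the sine subtraction formula confines r to the factors cos (t r) and sin (t
   r). At r = 0 the first is stationary and the second has slope t. *)
rewrite (_ : (fun r => \int[mu]_(x in setT) f r x) =
  fun r => cos (t * r) * A (th - pi / 2) t - sin (t * r) * A th t); last first.
  apply/funext => r; rewrite /f Rintegral_translation//; last first.
    by move=> x; exact: sin_max.
  transitivity (\int[mu]_x (cos (t * r) * (sin (t * x + th) * g x)
      - sin (t * r) * (cos (t * x + th) * g x))).
    apply: eq_Rintegral => x _.
    rewrite (_ : t * (x - r) + th = t * x + th - t * r); last by ring.
    by rewrite sinB; ring.
  rewrite RintegralB//=.
  - rewrite !RintegralZl//; last 2 first.
    + exact: integrable_cos_phase.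
    + exact: integrable_sin_phase.
    congr (_ * _ - _); apply: eq_Rintegral => x _.
    by rewrite addrA cosB cos_pihalf sin_pihalf mulr0 mulr1 add0r.
  - exact: (integrableZl measurableT (cos (t * r)) (integrable_sin_phase t th)).
  - exact: (integrableZl measurableT (sin (t * r)) (integrable_cos_phase t th)).
have -> : ((fun r => cos (t * r) * A (th - pi / 2) t - sin (t * r) * A th t)^`())%classic 0 =
   - t * A th t.
  have d0 (c : R) : is_derive (0 : R) 1 (fun r : R => c * r) c.
    by apply: is_derive_eq; rewrite /GRing.scale/=; ring.
  have ds : is_derive (0 : R) 1 (fun r => sin (t * r)) (cos (t * 0) * t).
    exact: (is_derive1_comp (is_derive_sin _) (d0 t)).
  have dc : is_derive (0 : R) 1 (fun r => cos (t * r)) (- sin (t * 0) * t).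
    exact: (is_derive1_comp (is_derive_cos _) (d0 t)).
  rewrite derive1E; apply: (@derive_val _ _ _ _ _ _ _).
  by apply: is_derive_eq; rewrite /GRing.scale/= !mulr0 cos0 sin0; ring.
(* Multiplying by s^2 cancels the 1 / s^2 in the derivative of the density. *)
move=> /(congr1 ( *%R (s ^+ 2))); rewrite mulNr mulrN mulrA -!mulNr => ->.
rewrite -RintegralZl//; last first.
  apply: (le_integrable _ _ _ intG') => //.
    apply/measurable_EFinP; rewrite (_ : partial1of2 f 0 =
      fun x => sin (t * x + th) * (- x / s ^+ 2 * g x)); last first.
      by apply/funext => x; rewrite d1f addr0.
    apply: measurable_funM; first exact: continuous_measurable_fun.
    apply: measurable_funM; last exact: measurable_normal_pdf.
    by apply: measurable_funM => //; exact: measurable_funN.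
  move=> x _ /=; rewrite lee_fin (ger0_norm (G'0 x)).
  exact: d1f_ub.
apply: eq_Rintegral => x _; rewrite d1f addr0; field.
exact: sN0.
Qed.

(** By A' = - s^2 t A, the product of A with exp (s^2 t^2 / 2) has zero derivative in t, so it keeps
    its value cos th at t = 0. *)
Lemma gaussian_cos th t :
  \int[mu]_x (cos (t * x + th) * g x) = cos th * expR (- (s ^+ 2 * t ^+ 2) / 2).
Proof.
pose h r := A th r * expR ((s ^+ 2 * r ^+ 2) / 2).
have dh (r : R) : is_derive r 1 h 0.
  have dp : is_derive r 1 (fun y : R => (s ^+ 2 * y ^+ 2) / 2) (s ^+ 2 * r).
    by apply: is_derive_eq; rewrite /GRing.scale/=; field.
  have dc := is_derive1_comp (is_derive_expR _) dp.
  have := dA th r; rewrite translation_derivative => dA'.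
  by apply: is_derive_eq; rewrite /GRing.scale/=; ring.
have := is_derive_0_is_cst t 0 dh.
rewrite /h expr0n/= mulr0 mul0r expR0 mulr1 /A => AE.
have e : expR (s ^+ 2 * t ^+ 2 / 2) * expR (- (s ^+ 2 * t ^+ 2) / 2) = 1.
  by rewrite -expRD mulNr subrr expR0.
rewrite -[LHS]mulr1 -[X in _ * X = _]e mulrA AE; congr (_ * _).
under eq_Rintegral do rewrite mul0r add0r.
rewrite RintegralZl//; last exact: integrable_normal_pdf.
by rewrite /Rintegral integral_normal_pdf/= mulr1.
Qed.

(** The Radon-Nikodym derivative of [normal_prob 0 s] agrees almost everywhere with the density,
    since the two have the same integral over every measurable set. *)
Lemma integral_normal_prob (f : R -> R) : measurable_fun setT f ->
  (forall x, `|f x| <= 1) ->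
  (\int[normal_prob 0 s]_x (f x)%:E = \int[mu]_x (f x * g x)%:E)%E.
Proof.
move=> mf f1.
have intf : (normal_prob 0 s).-integrable setT (EFin \o f).
  exact: (integrable_bounded (normal_prob 0 s) mf f1).
rewrite -(Radon_Nikodym_change_of_variables (normal_prob_dominates 0 s))//=.
under [RHS]eq_integral do rewrite EFinM.
apply: ae_eq_integral => //.
- apply: emeasurable_funM; first exact/measurable_EFinP.
  by apply: (measurable_int mu); apply: Radon_Nikodym_integrable;
    exact: normal_prob_dominates.
- apply: emeasurable_funM; first exact/measurable_EFinP.
  by apply/measurable_EFinP; exact: measurable_normal_pdf.
- apply: ae_eqe_mul2l => /=.
  rewrite Radon_NikodymE//=; first exact: normal_prob_dominates.
  move=> dom; case: cid => /= k [k1 k2 k3].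
  apply: integral_ae_eq => //=.
  + by apply/measurable_EFinP; exact: measurable_normal_pdf.
  + by move=> E _ mE; rewrite -k3.
Qed.

Lemma integral_cos_normal_RV d (T : measurableType d) (P : probability T R)
    (X : T -> R) th t : measurable_fun setT X ->
  (forall B, measurable B -> P (X @^-1` B) = normal_prob 0 s B) ->
  (\int[P]_w (cos (t * X w + th))%:E
    = (cos th * expR (- (s ^+ 2 * t ^+ 2) / 2))%:E)%E.
Proof.
move=> mX lawX; have mc : measurable_fun setT (fun x : R => cos (t * x + th)).
  exact: continuous_measurable_fun.
have intc : P.-integrable setT (EFin \o (fun w => cos (t * X w + th))).
  by apply: (integrable_bounded _ (M := 1) (measurableT_comp mc mX)) => w;
    exact: cos_max.
rewrite -(integral_pushforward mX (D := setT)
  (f := fun x => (cos (t * x + th))%:E))//; last exact/measurable_EFinP.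
(* The identity transports [normal_prob 0 s] to the copy of the real line on which the law of [X]
   lives. *)
pose idR : measurableTypeR R -> R := id.
have mid : measurable_fun setT idR by move=> _ B mB; rewrite setTI.
transitivity (\int[normal_prob 0 s]_x (cos (t * x + th))%:E)%E.
  rewrite (eq_measure_integral (pushforward (normal_prob 0 s) idR)) => [|B mB _].
    rewrite integral_pushforward//; first exact/measurable_EFinP.
    by apply: (integrable_bounded (normal_prob 0 s) (M := 1) mc) => x; exact: cos_max.
  exact: lawX.
rewrite integral_normal_prob//; last by move=> x; exact: cos_max.
rewrite -gaussian_cos /Rintegral fineK//.
by apply: integrable_fin_num => //; exact: integrable_cos_phase.
Qed.
End gaussian_trigonometric.

(** * The exponential moment of a bounded variable *)

Lemma measurable_sum_in d (T : measurableType d) (R : realType) (I : eqType)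
    (r : seq I) (h : I -> T -> R) :
  (forall i, i \in r -> measurable_fun setT (h i)) ->
  measurable_fun setT (fun w => \sum_(i <- r) h i w).
Proof.
elim: r => [_|i r IH mh].
  by under eq_fun do rewrite big_nil; exact: measurable_cst.
under eq_fun do rewrite big_cons.
apply: measurable_funD; first by apply: mh; exact: mem_head.
by apply: IH => j jr; apply: mh; rewrite inE jr orbT.
Qed.

(** Convexity: x y is the combination of x and - x with weights (1 + y) / 2 and (1 - y) / 2. The
    tangent at x y lies below the graph at both ends, and its linear terms cancel in the weighted
    sum. *)
Lemma expR_chord_le (R : realType) (x y : R) : `|y| <= 1 ->
  expR (x * y) <= (1 + y) / 2 * expR x + (1 - y) / 2 * expR (- x).
Proof.
rewrite ler_norml => /andP[y1 y2].
have tangent z : expR (x * y) * (1 + z) <= expR (x * y + z).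
  by rewrite expRD ler_pM2l ?expR_gt0// expR_ge1Dx.
have t1 := tangent (x - x * y); have t2 := tangent (- x - x * y).
rewrite !subrKC in t1 t2.
have -> : expR (x * y) = (1 + y) / 2 * (expR (x * y) * (1 + (x - x * y)))
    + (1 - y) / 2 * (expR (x * y) * (1 + (- x - x * y))) by field.
by apply: lerD; apply: ler_wpM2l => //; lra.
Qed.

(** Hoeffding's lemma on [-1, 1]: the chord bounds exp (x Y) by an affine function of Y, whose mean
    depends only on [m] and is the two-point exponential moment. *)
Lemma mgf_bounded_le d (T : measurableType d) (R : realType)
    (P : probability T R) (Y : T -> R) m x : measurable_fun setT Y ->
  (forall w, `|Y w| <= 1) -> (\int[P]_w (Y w)%:E = m%:E)%E ->
  (\int[P]_w (expR (x * (Y w - m)))%:E <= (expR (x ^+ 2 / 2))%:E)%E.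
Proof.
move=> mY Y1 EY.
have intY : P.-integrable setT (EFin \o Y) := integrable_bounded P mY Y1.
have m1 : `|m| <= 1.
  rewrite -lee_fin -[`|m|%:E]/(`|m%:E|)%E -EY.
  apply: le_trans (le_abse_integral _ _ _) _ => //; first exact/measurable_EFinP.
  apply: le_trans (integral_le_bound 1 _ _ _ _) _ => //.
  - exact/measurable_EFinP.
  - by apply: aeW => w _; rewrite lee_fin Y1.
  - by rewrite mul1e probability_le1.
(* These are cosh x and sinh x, so that the chord is a + b Y. *)
pose a := (expR x + expR (- x)) / 2; pose b := (expR x - expR (- x)) / 2.
have intab : P.-integrable setT (fun w => (expR (- (x * m)) * (a + b * Y w))%:E).
  apply: (integrable_bounded P (M := expR (- (x * m)) * (`|a| + `|b|))).
    apply: measurable_funM => //; apply: measurable_funD => //.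
    exact: measurable_funM.
  move=> w; rewrite normrM ger0_norm ?expR_ge0// ler_pM2l ?expR_gt0//.
  by rewrite (le_trans (ler_normD _ _))// lerD2l normrM ler_piMr.
apply: (@le_trans _ _ (\int[P]_w (expR (- (x * m)) * (a + b * Y w))%:E)%E).
  apply: ge0_le_integral => [//|w _|||w _].
  - by rewrite lee_fin expR_ge0.
  - apply/measurable_EFinP; apply: (measurableT_comp (@measurable_expR R)).
    by apply: measurable_funM => //; exact: measurable_funB.
  - by case/integrableP: intab.
  - rewrite lee_fin mulrBr expRD mulrC ler_pM2l ?expR_gt0//.
    rewrite (le_trans (expR_chord_le _ (Y1 w)))//.
    by rewrite le_eqVlt; apply/orP; left; apply/eqP; rewrite /a /b; field.
under eq_integral do rewrite EFinM.
rewrite integralZl//; last first.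
  under eq_fun do rewrite EFinD; apply: integrableD => //.
    by apply: (integrable_bounded P (M := `|a|)).
  under eq_fun do rewrite EFinM; exact: (integrableZl measurableT b intY).
under eq_integral do rewrite EFinD EFinM.
rewrite integralD//; last 2 first.
- by apply: (integrable_bounded P (M := `|a|)).
- exact: (integrableZl measurableT b intY).
rewrite (integralZl measurableT intY) EY integral_cst//= probability_setT mule1.
rewrite -(EFinM b) -EFinD -EFinM lee_fin.
rewrite -(ler_pM2l (expR_gt0 (x * m))) mulrA -expRD subrr expR0 mul1r -expRD.
rewrite (le_trans _ (two_point_mgf_le x m1))//.
by rewrite le_eqVlt; apply/orP; left; apply/eqP; rewrite /a /b; field.
Qed.

(** * Independence and decoupling *)

Section independent_pair.
Context d (T : measurableType d) (R : realType) (P : probability T R).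
Context d1 d2 (T1 : measurableType d1) (T2 : measurableType d2).
Variables (Y1 : {mfun T >-> T1}) (Y2 : {mfun T >-> T2}).
Hypothesis indep : forall A B, measurable A -> measurable B ->
  P (Y1 @^-1` A `&` Y2 @^-1` B) = (P (Y1 @^-1` A) * P (Y2 @^-1` B))%E.

Let Y w := (Y1 w, Y2 w).
Let mY : measurable_fun setT Y.
Proof. exact: measurable_fun_pair. Qed.
HB.instance Definition _ := isMeasurableFun.Build _ _ _ _ Y mY.

(** By independence the joint law and the product law agree on rectangles, which determine a product
    measure. *)
Let law_pair C : measurable C ->
  (distribution P Y1 \x distribution P Y2)%E C = distribution P Y C.
Proof.
by apply: product_measure_unique => A B mA mB; rewrite /= /distribution -indep.
Qed.

Lemma probability_pair C : measurable C ->
  P [set w | C (Y1 w, Y2 w)] = (\int[P]_w P [set w' | C (Y1 w, Y2 w')])%E.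
Proof.
move=> mC; rewrite -[LHS]/(distribution P Y C) -law_pair// /product_measure1.
rewrite ge0_integral_distribution//; last exact: measurable_fun_xsection.
apply: eq_integral => w _ /=; congr (P _).
by apply/seteqP; split => w' /=; rewrite /xsection/= inE.
Qed.

(** This replaces conditioning on [Y1]: a bound valid for each frozen value of [Y1] survives
    integration. *)
Lemma probability_pair_le C c : measurable C ->
  (forall w, P [set w' | C (Y1 w, Y2 w')] <= c)%E ->
  (P [set w | C (Y1 w, Y2 w)] <= c)%E.
Proof.
move=> mC Cc; rewrite probability_pair//.
have secE w : P [set w' | C (Y1 w, Y2 w')] = distribution P Y2 (xsection C (Y1 w)).
  by congr (P _); apply/seteqP; split => w' /=; rewrite /xsection/= inE.
apply: (@le_trans _ _ (\int[P]_w c)%E); last first.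
  by rewrite integral_cst//= probability_setT mule1.
apply: ge0_le_integral => [//|w _|||w _]; [exact: measure_ge0| |exact: measurable_cst|exact: Cc].
under eq_fun do rewrite secE.
exact: (measurableT_comp (measurable_fun_xsection (distribution P Y2) mC)).
Qed.

Lemma ge0_integral_pair (f : T1 * T2 -> \bar R) : measurable_fun setT f ->
  (forall z, 0 <= f z)%E ->
  (\int[P]_w f (Y1 w, Y2 w) = \int[P]_w \int[P]_w' f (Y1 w, Y2 w'))%E.
Proof.
move=> mf f0; have -> : (\int[P]_w f (Y1 w, Y2 w) = \int[distribution P Y]_z f z)%E.
  by rewrite ge0_integral_distribution.
rewrite -(eq_measure_integral _ (fun C mC _ => law_pair mC)).
rewrite fubini_tonelli1// ge0_integral_distribution//; last 2 first.
- exact: measurable_fun_fubini_tonelli_F.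
- by move=> y; apply: integral_ge0.
apply: eq_integral => w _; rewrite /fubini_F /= ge0_integral_distribution//.
by apply: (measurableT_comp mf); exact: measurable_fun_pair.
Qed.

Lemma integral_pair (f : T1 * T2 -> R) M : measurable_fun setT f ->
  (forall z, `|f z| <= M) ->
  (\int[P]_w (f (Y1 w, Y2 w))%:E
    = \int[P]_w \int[P]_w' (f (Y1 w, Y2 w'))%:E)%E.
Proof.
move=> mf fM.
have bf d' (S : measurableType d') (m : probability S R) (h : S -> T1 * T2) :
    measurable_fun setT h -> m.-integrable setT (fun z => (f (h z))%:E).
  by move=> mh; apply: (integrable_bounded _ (M := M) (measurableT_comp mf mh)) => w;
    exact: fM.
have mfE : measurable_fun setT (EFin \o f) by exact/measurable_EFinP.
have -> : (\int[P]_w (f (Y1 w, Y2 w))%:E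
    = \int[distribution P Y]_z (f z)%:E)%E.
  by rewrite integral_distribution//; exact: bf.
rewrite -(eq_measure_integral _ (fun C mC _ => law_pair mC)).
have intf := bf _ _ (distribution P Y1 \x distribution P Y2)%E id (@measurable_id _ _ _).
rewrite -integral12_prod_meas1//= integral_distribution//=; last 2 first.
- exact: (measurable_fubini_F intf).
- have /integrableP[mF FM] := integrable_fubini_F intf.
  apply/integrableP; split; first exact: measurableT_comp.
  by rewrite -(ge0_integral_distribution Y1 (f := fun x => `|fubini_F _ _ x|%E))//;
    exact: measurableT_comp.
apply: eq_integral => w _.
have mfw : measurable_fun setT (fun y => (f (Y1 w, y))%:E).
  by apply: (measurableT_comp mfE); exact: measurable_fun_pair.
rewrite /fubini_F integral_distribution//.
by apply: (integrable_bounded _ (M := M)) => //; apply: (measurableT_comp mf);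
  exact: measurable_fun_pair.
Qed.
End independent_pair.

(** * Sigma-algebras generated by subfamilies *)

Section independent_family.
Context d (T : measurableType d) (R : realType) (P : probability T R).
Variables (I : finType) (X : I -> T -> R).
Hypothesis mX : forall i, measurable_fun setT (X i).
Hypothesis indepX : mutually_independent P X.
Implicit Types J K : {set I}.

(** A pi-system on which independence can be read off directly; [family_indep] extends it to the
    generated sigma-algebra. *)
Definition cylinder J : set (set T) :=
  [set A | exists2 B : I -> set R, (forall i, measurable (B i)) &
     A = \bigcap_(i in [set i | i \in J]) X i @^-1` B i].

(* The sigma-algebra generated by (X i), i in J, carried by the sample space itself. *)
Definition family_type J := g_sigma_algebraType (cylinder J).

HB.instance Definition _ J := Measurable.on (family_type J).

Lemma cylinderT J : cylinder J setT.
Proof.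
exists (fun=> setT) => //; apply/seteqP; split => w //= _ i _.
Qed.

Lemma cylinderI J : setI_closed (cylinder J).
Proof.
move=> _ _ [B mB ->] [C mC ->]; exists (fun i => B i `&` C i).
  by move=> i; exact: measurableI.
apply/seteqP; split => w /= => [[wB wC] i iJ|wBC].
  by split; [exact: wB|exact: wC].
by split=> i iJ; have [] := wBC i iJ.
Qed.

Lemma cylinder_measurable J A : cylinder J A -> measurable A.
Proof.
move=> [B mB ->]; apply: fin_bigcap_measurable => [|i _].
  exact: finite_finset.
by rewrite -[_ @^-1` _]setTI; exact: mX.
Qed.

Lemma cylinder_sub J K : J \subset K -> cylinder J `<=` cylinder K.
Proof.
move=> /fintype.subsetP JK _ [B mB ->].
exists (fun i => if i \in J then B i else setT) => [i|].
  by case: ifPn.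
apply/seteqP; split => w /= wB i => [iK|iJ].
  by case: ifPn => // iJ; exact: wB.
by have := wB i (JK _ iJ); rewrite iJ.
Qed.

(** Disjointness allows the two families of Borel sets to be merged into one family [E];
    independence is then used on [J], on [K] and on their union. *)
Lemma cylinder_indep J K A B : [disjoint J & K]%B -> cylinder J A -> cylinder K B ->
  P (A `&` B) = (P A * P B)%E.
Proof.
move=> dJK [C mC ->] [D mD ->].
pose E i := if i \in J then C i else D i.
have mE i : measurable (E i) by rewrite /E; case: ifPn.
have EJ : \bigcap_(i in [set i | i \in J]) X i @^-1` C i =
          \bigcap_(i in [set i | i \in J]) X i @^-1` E i.
  by apply: eq_bigcapr => i /= iJ; rewrite /E iJ.
have EK : \bigcap_(i in [set i | i \in K]) X i @^-1` D i =
          \bigcap_(i in [set i | i \in K]) X i @^-1` E i.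
  by apply: eq_bigcapr => i /= iK; rewrite /E (disjointFl dJK).
rewrite EJ EK -bigcap_setU.
rewrite (_ : [set i | i \in J] `|` [set i | i \in K] = [set i | i \in J :|: K]).
  rewrite !indepX// (eq_bigl (fun i => i \in [predU J & K])) ?bigU//.
  by move=> i; rewrite !inE.
apply/seteqP; split => i /=; rewrite inE.
  by case=> ->; rewrite ?orbT.
by move=> /orP[]; [left|right].
Qed.

Lemma family_measurable J A : measurable (A : set (family_type J)) ->
  measurable (A : set T).
Proof.
have : <<s cylinder J >> `<=` @measurable _ T.
  by apply: smallest_sub; [exact: sigma_algebra_measurable|exact: cylinder_measurable].
exact.
Qed.

Lemma measurable_fun_family_id J : measurable_fun setT (id : T -> family_type J).
Proof. by move=> _ B mB; rewrite setTI; exact: family_measurable mB. Qed.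

(** The uniqueness theorem for measures agreeing on a pi-system is used twice, enlarging one side at
    a time from cylinders to the generated sigma-algebra. *)
Lemma family_indep J K A B : [disjoint J & K]%B ->
  measurable (A : set (family_type J)) -> measurable (B : set (family_type K)) ->
  P (A `&` B) = (P A * P B)%E.
Proof.
move=> dJK mA mB.
pose pr C : {nonneg R} := NngNum (fine_ge0 (measure_ge0 P C)).
have prE C : measurable C -> ((pr C)%:num%:E = P C)%E.
  by move=> mC; rewrite /= fineK// fin_num_measure.
(* For fixed D in G', the measures C -> P (C & D) and C -> P D * P C agree on the pi-system G, hence
   on the sigma-algebra it generates. *)
have step (G G' : set (set T)) : setI_closed G -> G setT ->
    G `<=` measurable -> G' `<=` measurable ->
    (forall C D, G C -> G' D -> P (C `&` D) = P C * P D)%E ->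
    forall C D, <<s G >> C -> G' D -> (P (C `&` D) = P C * P D)%E.
  move=> GI GT Gm G'm GG' C D sC G'D; have mD := G'm _ G'D.
  rewrite [RHS]muleC -[X in (X * _)%E]prE//.
  apply: (g_sigma_algebra_measure_unique G Gm (fun=> setT) _ _
    (mrestr P mD) (mscale (pr D) P)) sC => //.
  - by rewrite bigcup_const.
  - move=> A' GA'; change (P (A' `&` D) = (pr D)%:num%:E * P A')%E.
    by rewrite prE// muleC GG'.
  - move=> _; change (P (setT `&` D) < +oo)%E.
    by rewrite setTI (le_lt_trans (probability_le1 _ _)) ?ltry.
have indepJ C D : <<s cylinder J >> C -> cylinder K D -> (P (C `&` D) = P C * P D)%E.
  apply: step; [exact: cylinderI|exact: cylinderT|exact: cylinder_measurable
    |exact: cylinder_measurable|by move=> ? ? ? ?; exact: (cylinder_indep dJK)].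
(* The roles are exchanged: now the cylinders of [K] are enlarged, against all measurable sets of
   [family_type J]. *)
rewrite setIC muleC.
apply: (step (cylinder K) (@measurable _ (family_type J))) => //.
- exact: cylinderI.
- exact: cylinderT.
- exact: cylinder_measurable.
- by move=> C; exact: family_measurable.
- by move=> C D KC JD; rewrite setIC muleC; exact: indepJ.
Qed.

Lemma measurable_family_coord J i : i \in J ->
  measurable_fun setT (X i : family_type J -> R).
Proof.
move=> iJ _ B mB; rewrite setTI; apply: sub_sigma_algebra.
exists (fun j => if j == i then B else setT) => [j|]; first by case: ifPn.
apply/seteqP; split => w /= => [XB j _|/(_ i iJ)]; last by rewrite eqxx.
by case: eqP => // ->.
Qed.

Lemma measurable_family_sub J K (f : T -> R) : J \subset K ->
  measurable_fun setT (f : family_type J -> R) ->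
  measurable_fun setT (f : family_type K -> R).
Proof.
move=> JK mf _ B mB; have := mf measurableT B mB.
exact: (@sub_smallest2r _ _ _ _ _ (cylinder_sub JK)).
Qed.

Lemma measurable_family J (f : T -> R) :
  measurable_fun setT (f : family_type J -> R) -> measurable_fun setT f.
Proof. by move=> mf _ B mB; apply: (@family_measurable J); exact: mf. Qed.

(** The identity is named so that it can carry the structure of a measurable map into the smaller
    sigma-algebra, and thus serve as a random element in the lemmas on pairs. *)
Definition to_family J : T -> family_type J := id.

HB.instance Definition _ J :=
  isMeasurableFun.Build _ _ _ _ (to_family J) (@measurable_fun_family_id J).

Lemma family_probability_pair_le J K (C : set (family_type J * family_type K)) c :
  [disjoint J & K]%B -> measurable C ->
  (forall w, P [set w' | C (w, w')] <= c)%E -> (P [set w | C (w, w)] <= c)%E.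
Proof.
move=> dJK mC.
apply: (probability_pair_le (Y1 := to_family J) (Y2 := to_family K)) => //.
by move=> A B mA mB; exact: (family_indep dJK).
Qed.

Lemma family_integral_pair J K (f : family_type J * family_type K -> R) M :
  [disjoint J & K]%B -> measurable_fun setT f -> (forall z, `|f z| <= M) ->
  (\int[P]_w (f (w, w))%:E = \int[P]_w \int[P]_w' (f (w, w'))%:E)%E.
Proof.
move=> dJK mf fM.
apply: (integral_pair (Y1 := to_family J) (Y2 := to_family K) _ mf fM).
by move=> A B mA mB; exact: (family_indep dJK).
Qed.

Lemma family_ge0_integral_pair J K (f : family_type J * family_type K -> \bar R) :
  [disjoint J & K]%B -> measurable_fun setT f -> (forall z, 0 <= f z)%E ->
  (\int[P]_w f (w, w) = \int[P]_w \int[P]_w' f (w, w'))%E.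
Proof.
move=> dJK mf f0.
apply: (ge0_integral_pair (Y1 := to_family J) (Y2 := to_family K) _ mf f0).
by move=> A B mA mB; exact: (family_indep dJK).
Qed.

Lemma measurable_family_sum J (r : seq I) (a : I -> R) : {subset r <= J} ->
  measurable_fun setT ((fun w => \sum_(i <- r) a i * X i w) : family_type J -> R).
Proof.
move=> rJ; apply: measurable_sum_in => i ir; apply: measurable_funM => //.
by apply: measurable_family_coord; exact: rJ.
Qed.

(** Induction on [r]: the head coordinate is integrated out with all the others frozen inside the
    phase. This leaves a Gaussian factor times the cosine of the shorter sum. *)
Lemma integral_cos_sum (s : R) (r : seq I) (a : I -> R) th : 0 < s -> uniq r ->
  (forall i, i \in r -> forall B, measurable B -> P (X i @^-1` B) = normal_prob 0 s B) ->
  (\int[P]_w (cos (\sum_(i <- r) a i * X i w + th))%:E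
    = (cos th * expR (- (s ^+ 2 * \sum_(i <- r) a i ^+ 2) / 2))%:E)%E.
Proof.
move=> s0; elim: r th => [th _ _|i r IH th /= /andP[ir ur] lawX].
  under eq_integral do rewrite big_nil add0r.
  rewrite integral_cst//= probability_setT mule1.
  by rewrite big_nil mulr0 oppr0 mul0r expR0 mulr1.
pose J : {set I} := [set j in r]%SET; pose K : {set I} := [set i]%SET.
have dJK : [disjoint J & K]%B.
  by rewrite /K disjoint_sym disjoints1 inE.
pose S (w : T) := \sum_(j <- r) a j * X j w.
have mS : measurable_fun setT (S : family_type J -> R).
  by apply: measurable_family_sum => j jr; rewrite inE.
pose f (z : family_type J * family_type K) := cos (a i * X i z.2 + (S z.1 + th)).
have mf : measurable_fun setT f.
  apply: (measurableT_comp (continuous_measurable_fun (@continuous_cos R))).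
  apply: measurable_funD.
    apply: measurable_funM => //.
    apply: (measurableT_comp _ measurable_snd).
    by apply: (@measurable_family_coord K); rewrite inE.
  by apply: measurable_funD => //; exact: (measurableT_comp mS measurable_fst).
transitivity (\int[P]_w (f (w, w))%:E)%E.
  by apply: eq_integral => w _; rewrite /f big_cons/= addrA.
rewrite (family_integral_pair dJK mf (M := 1)); last by move=> z; exact: cos_max.
under eq_integral => w _.
  rewrite /f/= (integral_cos_normal_RV s0) //; last by apply: lawX; exact: mem_head.
  rewrite EFinM.
  over.
rewrite integralZr//=; last first.
  apply: (integrable_bounded P (M := 1)) => [|w]; last exact: cos_max.
  apply: (measurableT_comp (continuous_measurable_fun (@continuous_cos R))).
  apply: measurable_funD => //; exact: (measurable_family mS).
rewrite IH//; last by move=> j jr; apply: lawX; rewrite inE jr orbT.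
rewrite -EFinM -mulrA -expRD; congr (_ * expR _)%:E.
by rewrite big_cons; ring.
Qed.

(** * Hoeffding's inequality *)

Section hoeffding.
Variables (N : nat) (J : 'I_N -> {set I}) (Y : 'I_N -> T -> R) (m : R).
Hypothesis dJ : forall q q', q != q' -> [disjoint J q & J q']%B.
Hypothesis mY : forall q, measurable_fun setT (Y q : family_type (J q) -> R).
Hypothesis Y1 : forall q w, `|Y q w| <= 1.
Hypothesis EY : forall q, (\int[P]_w (Y q w)%:E = m%:E)%E.

(** The exponential of the sum is a product of a factor carried by [J q] and one carried by the
    remaining blocks; these decouple, and each is bounded separately. *)
Lemma mgf_sum_bounded_le x (r : seq 'I_N) : uniq r ->
  (\int[P]_w (expR (x * \sum_(q <- r) (Y q w - m)))%:E
    <= (expR ((size r)%:R * (x ^+ 2 / 2)))%:E)%E.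
Proof.
elim: r => [_|q r IH /= /andP[qr ur]].
  under eq_integral do rewrite big_nil mulr0 expR0.
  by rewrite integral_cst//= probability_setT mule1 mul0r expR0.
pose K : {set I} := (\bigcup_(q' in r) J q')%SET.
have dJK : [disjoint J q & K]%B.
  apply: finset.bigcup_disjoint => q' q'r.
  by apply: dJ; apply: contraNneq qr => ->.
pose A w := expR (x * (Y q w - m)).
pose B w := expR (x * \sum_(q' <- r) (Y q' w - m)).
have mA : measurable_fun setT (A : family_type (J q) -> R).
  apply: (measurableT_comp (@measurable_expR R)); apply: measurable_funM => //.
  exact: measurable_funB.
have mB : measurable_fun setT (B : family_type K -> R).
  apply: (measurableT_comp (@measurable_expR R)); apply: measurable_funM => //.
  apply: measurable_sum_in => q' q'r; apply: measurable_funB => //.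
  by apply: (measurable_family_sub _ (@mY q')); exact: (finset.bigcup_sup q').
have mAE : measurable_fun setT (fun w => (A w)%:E).
  by apply/measurable_EFinP; exact: (measurable_family mA).
have mBE : measurable_fun setT (fun w => (B w)%:E).
  by apply/measurable_EFinP; exact: (measurable_family mB).
have A0 w : (0 <= (A w)%:E)%E by rewrite lee_fin expR_ge0.
have B0 w : (0 <= (B w)%:E)%E by rewrite lee_fin expR_ge0.
pose f (z : family_type (J q) * family_type K) := ((A z.1)%:E * (B z.2)%:E)%E.
have mf : measurable_fun setT f.
  apply: emeasurable_funM; apply/measurable_EFinP.
    exact: (measurableT_comp mA measurable_fst).
  exact: (measurableT_comp mB measurable_snd).
have -> : (\int[P]_w (expR (x * \sum_(j <- q :: r) (Y j w - m)))%:E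
    = \int[P]_w f (w, w))%E.
  by apply: eq_integral => w _; rewrite /f -EFinM -expRD big_cons mulrDr.
rewrite (family_ge0_integral_pair dJK mf); last by move=> z; exact: mule_ge0.
under eq_integral => w _.
  rewrite /f/= ge0_integralZl//.
  over.
rewrite /= ge0_integralZr//; last by apply: integral_ge0.
rewrite -natr1 addrC mulrDl mul1r expRD EFinM.
apply: lee_pmul => //; [exact: integral_ge0|exact: integral_ge0| |exact: IH].
apply: mgf_bounded_le; [exact: (measurable_family (@mY q))|exact: Y1|exact: EY].
Qed.

(** Markov's inequality for exp (e S). The parameter x = e minimises the exponent - x N e + N x^2 /
    2. *)
Lemma chernoff_upper e : (0 < N)%N -> 0 < e ->
  (P [set w | (N%:R * e <= \sum_(q < N) (Y q w - m))%R]
    <= (expR (- (N%:R * e ^+ 2) / 2))%:E)%E.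
Proof.
move=> N0 e0; pose S w := \sum_(q < N) (Y q w - m).
have mS : measurable_fun setT S.
  apply: measurable_sum_in => q _; apply: measurable_funB => //.
  exact: (measurable_family (@mY q)).
have mE : measurable [set w | N%:R * e <= S w].
  rewrite -[X in measurable X]setTI; exact: measurable_fun_le.
pose c := expR (- (e * (N%:R * e))).
have mexp : measurable_fun setT (fun w => (expR (e * S w))%:E).
  apply/measurable_EFinP; apply: (measurableT_comp (@measurable_expR R)).
  exact: measurable_funM.
apply: (@le_trans _ _ (\int[P]_w (c%:E * (expR (e * S w))%:E))%E).
  (* The indicator of the event is at most c exp (e S). *)
  rewrite -[X in P X]setIT -integral_indic//.
  apply: ge0_le_integral => [//|w _|||w _].
  - by rewrite lee_fin.
  - by apply/measurable_EFinP.
  - exact: measurable_funeM.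
  - rewrite -EFinM lee_fin /c -expRD indicE; case: (boolP (w \in _)) => [|_].
      rewrite inE/= => NS; rewrite -[leLHS]expR0 ler_expR addrC subr_ge0.
      by rewrite ler_pM2l.
    by rewrite expR_ge0.
rewrite ge0_integralZl//; last by rewrite lee_fin expR_ge0.
have := mgf_sum_bounded_le e (index_enum_uniq 'I_N).
have -> : size (index_enum 'I_N) = N.
  by rewrite [index_enum _]unlock -enumT size_enum_ord.
move=> mgf.
apply: (@le_trans _ _ (c%:E * (expR (N%:R * (e ^+ 2 / 2)))%:E)%E).
  by apply: lee_wpmul2l mgf; rewrite lee_fin expR_ge0.
rewrite -EFinM lee_fin /c -expRD ler_expR.
by rewrite le_eqVlt; apply/orP; left; apply/eqP; field.
Qed.

End hoeffding.

(** The two tails are the upper tails of [Y] and of [- Y]. Independence of the variables is encoded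
    by the disjoint blocks [J q] of the underlying family that carry them. *)
Lemma hoeffding N (J : 'I_N -> {set I}) (Y : 'I_N -> T -> R) m e :
  (0 < N)%N -> 0 < e ->
  (forall q q', q != q' -> [disjoint J q & J q']%B) ->
  (forall q, measurable_fun setT (Y q : family_type (J q) -> R)) ->
  (forall q w, `|Y q w| <= 1) ->
  (forall q, (\int[P]_w (Y q w)%:E = m%:E)%E) ->
  (P [set w | (e <= `|(\sum_(q < N) Y q w) / N%:R - m|)%R]
    <= (2 * expR (- (N%:R * e ^+ 2) / 2))%:E)%E.
Proof.
move=> N0 e0 dJ mY Y1 EY.
have mYT q : measurable_fun setT (Y q) := measurable_family (mY q).
have N0R : 0 < N%:R :> R by rewrite ltr0n.
have mYN q : measurable_fun setT (- Y q : family_type (J q) -> R) by exact: measurable_funN.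
have YN1 q w : `|(- Y q) w| <= 1 by rewrite /= normrN.
have EYN q : (\int[P]_w ((- Y q) w)%:E = (- m)%:E)%E.
  rewrite EFinN -(EY q) -integralN//.
  exact: (integrable_add_def measurableT (integrable_bounded P (mYT q) (Y1 q))).
have mS (Z : 'I_N -> T -> R) (k : R) : (forall q, measurable_fun setT (Z q)) ->
    measurable [set w | N%:R * e <= \sum_(q < N) (Z q w - k)].
  move=> mZ; rewrite -[X in measurable X]setTI; apply: measurable_fun_le => //.
  by apply: measurable_sum_in => q _; exact: measurable_funB.
pose U := [set w | N%:R * e <= \sum_(q < N) (Y q w - m)].
pose L := [set w | N%:R * e <= \sum_(q < N) ((- Y q) w - - m)].
have mU : measurable U by exact: mS.
have mL : measurable L by apply: mS => q; exact: measurable_funN.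
apply: (@le_trans _ _ (P (U `|` L))).
  apply: le_measure; rewrite ?inE.
  - rewrite -[X in measurable X]setTI; apply: measurable_fun_le => //.
    apply: measurableT_comp => //; apply: measurable_funB => //.
    apply: measurable_funM => //;
    by apply: measurable_sum_in => q _.
  - exact: measurableU.
  - move=> w /=; have -> : (\sum_(q < N) Y q w) / N%:R - m
        = (\sum_(q < N) (Y q w - m)) / N%:R.
      rewrite sumrB sumr_const card_ord -[m *+ N]mulr_natr; field.
      by rewrite pnatr_eq0 -lt0n.
    rewrite normrM (gtr0_norm (_ : 0 < N%:R^-1)) ?invr_gt0//.
    rewrite ler_pdivlMr// mulrC ler_normr => /orP[?|le]; [by left|right].
    rewrite /L/=; under eq_bigr do rewrite opprK addrC -opprB.
    by rewrite sumrN.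
apply: (le_trans (measureU2 _ mU mL)).
rewrite mulrDl mul1r EFinD; apply: leeD.
  exact: (chernoff_upper dJ mY Y1 EY).
exact: (chernoff_upper dJ mYN YN1 EYN).
Qed.

End independent_family.

(** * Random Fourier features *)

Section random_features.
Variable R : realType.

(** Reindexing by k = 2 q + b, where b tells the sine entry from the cosine entry of block q. *)
Lemma sum_half_ord n (f : 'I_n -> bool -> R) :
  \sum_(k < 2 * n) f (half_ord k) (odd k) = \sum_(q < n) (f q false + f q true).
Proof.
have lt_n (p : 'I_n * bool) : (2 * p.1 + p.2 < 2 * n)%N.
  by case: p => [[q qn] []] /=; lia.
pose g p : 'I_(2 * n) := Ordinal (lt_n p).
rewrite (reindex g) /=; last first.
  exists (fun k => (half_ord k, odd k)) => [[q b] _|k _] /=.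
    congr pair; first by apply: val_inj => /=; case: b; lia.
    by rewrite oddD oddM /=; case: b.
  by apply: val_inj => /=; lia.
transitivity (\sum_(p : 'I_n * bool) f p.1 p.2).
  apply: eq_bigr => -[q b] _; congr f.
    by apply: val_inj => /=; case: b; lia.
  by rewrite /= oddD oddM; case: b.
rewrite -(pair_bigA _ f); apply: eq_bigr => q _.
by rewrite big_bool addrC.
Qed.

Lemma dotvBr n (w a b : 'I_n -> R) :
  dotv w a - dotv w b = \sum_(j < n) (a j - b j) * w j.
Proof. by rewrite /dotv -sumrB; apply: eq_bigr => j _; ring. Qed.

(** The cosine and sine entries of each block combine by the cosine subtraction formula. *)
Lemma dotv_zbar m Q (V : 'I_Q -> 'I_m -> R) (u u' : 'I_m -> R) :
  dotv (zbar V u) (zbar V u')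
    = (\sum_(q < Q) cos (\sum_(j < m) (u j - u' j) * V q j)) / Q%:R.
Proof.
pose f q (b : bool) := (Num.sqrt Q%:R)^-1 * cos_sin b (dotv (V q) u) *
  ((Num.sqrt Q%:R)^-1 * cos_sin b (dotv (V q) u')).
transitivity (\sum_(k < 2 * Q) f (half_ord k) (odd k)).
  by apply: eq_bigr => k _; rewrite /f /zbar /cos_sin; case: (odd k).
rewrite sum_half_ord mulr_suml; apply: eq_bigr => q _.
rewrite /f /cos_sin /= -dotvBr cosB.
rewrite -[X in _ / X](@sqr_sqrtr _ Q%:R)// expr2 invfM; ring.
Qed.

(** The squared modulus of the difference at [w] of the empirical characteristic functions of the
    two samples, split into real and imaginary parts. *)
Definition feature_dist2 (d n1 n2 : nat) (X : 'I_n1 -> 'I_d -> R)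
    (X' : 'I_n2 -> 'I_d -> R) (w : 'I_d -> R) : R :=
  ((\sum_(i < n1) cos (dotv w (X i))) / n1%:R
     - (\sum_(i < n2) cos (dotv w (X' i))) / n2%:R) ^+ 2
  + ((\sum_(i < n1) sin (dotv w (X i))) / n1%:R
     - (\sum_(i < n2) sin (dotv w (X' i))) / n2%:R) ^+ 2.

Lemma sqdist_ZP d L n1 n2 (W : 'I_L -> 'I_d -> R) (X : 'I_n1 -> 'I_d -> R)
    (X' : 'I_n2 -> 'I_d -> R) :
  sqdist (ZP W X) (ZP W X') = (\sum_(l < L) feature_dist2 X X' (W l)) / L%:R.
Proof.
pose h n (Y : 'I_n -> 'I_d -> R) l (b : bool) := (n%:R * Num.sqrt L%:R)^-1 *
  \sum_(i < n) cos_sin b (dotv (W l) (Y i)).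
pose f l (b : bool) := (h _ X l b - h _ X' l b) * (h _ X l b - h _ X' l b).
transitivity (\sum_(k < 2 * L) f (half_ord k) (odd k)).
  by apply: eq_bigr => k _; rewrite /f /h /ZP /cos_sin; case: (odd k).
rewrite sum_half_ord mulr_suml; apply: eq_bigr => l _.
rewrite /f /h /cos_sin /= /feature_dist2.
rewrite -[X in _ / X](@sqr_sqrtr _ L%:R)// expr2 !invfM; ring.
Qed.

Lemma sqdist_uvec d L n1 n2 (sP sX : R) (W : 'I_L -> 'I_d -> R)
    (X : 'I_n1 -> 'I_d -> R) (X' : 'I_n2 -> 'I_d -> R) (x x' : 'I_d -> R) :
  sqdist (uvec sP sX W X x) (uvec sP sX W X' x')
    = sX ^+ 2 * sqdist (ZP W X) (ZP W X') + sP ^+ 2 * sqdist x x'.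
Proof.
rewrite /sqdist /dotv big_split_ord /= !mulr_sumr; congr (_ + _).
  apply: eq_bigr => k _; rewrite /uvec.
  by rewrite -[lshift _ _]/(unsplit (inl _)) unsplitK; ring.
apply: eq_bigr => k _; rewrite /uvec.
by rewrite -[rshift _ _]/(unsplit (inr _)) unsplitK; ring.
Qed.

Lemma feature_dist2_ge0 d n1 n2 (X : 'I_n1 -> 'I_d -> R)
    (X' : 'I_n2 -> 'I_d -> R) w : 0 <= feature_dist2 X X' w.
Proof. by rewrite addr_ge0 ?sqr_ge0. Qed.

Lemma sum_cosB n1 n2 (a : 'I_n1 -> R) (b : 'I_n2 -> R) :
  \sum_(i < n1) \sum_(j < n2) cos (a i - b j)
    = (\sum_(i < n1) cos (a i)) * (\sum_(j < n2) cos (b j))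
      + (\sum_(i < n1) sin (a i)) * (\sum_(j < n2) sin (b j)).
Proof.
rewrite !mulr_suml -big_split; apply: eq_bigr => i _ /=.
by rewrite !mulr_sumr -big_split; apply: eq_bigr => j _; exact: cosB.
Qed.

(** Expanding the squares gives the shape of [mmd2], with cosines in the place of kernel values. *)
Lemma feature_dist2E d n1 n2 (X : 'I_n1 -> 'I_d -> R)
    (X' : 'I_n2 -> 'I_d -> R) w : (0 < n1)%N -> (0 < n2)%N ->
  feature_dist2 X X' w =
    (\sum_(i < n1) \sum_(j < n1) cos (dotv w (X i) - dotv w (X j))) / n1%:R ^+ 2
  + (\sum_(i < n2) \sum_(j < n2) cos (dotv w (X' i) - dotv w (X' j))) / n2%:R ^+ 2
  - 2 * (\sum_(i < n1) \sum_(j < n2) cos (dotv w (X i) - dotv w (X' j)))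
    / (n1%:R * n2%:R).
Proof.
move=> n10 n20; rewrite !sum_cosB /feature_dist2; field.
by rewrite !pnatr_eq0 -!lt0n n10 n20.
Qed.

Lemma norm_sum_cos_le n1 n2 (a : 'I_n1 -> 'I_n2 -> R) :
  `|\sum_(i < n1) \sum_(j < n2) cos (a i j)| <= n1%:R * n2%:R.
Proof.
apply: (le_trans (ler_norm_sum _ _ _)).
apply: (@le_trans _ _ (\sum_(i < n1) n2%:R)).
  apply: ler_sum => i _; apply: (le_trans (ler_norm_sum _ _ _)).
  apply: (@le_trans _ _ (\sum_(j < n2) 1)).
    by apply: ler_sum => j _; exact: cos_max.
  by rewrite sumr_const card_ord.
by rewrite sumr_const card_ord -[leLHS]mulr_natl.
Qed.

(** The three double averages of cosines have modulus at most 1 and enter with coefficients 1, 1 and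
    - 2. *)
Lemma feature_dist2_le4 d n1 n2 (X : 'I_n1 -> 'I_d -> R)
    (X' : 'I_n2 -> 'I_d -> R) w : (0 < n1)%N -> (0 < n2)%N ->
  feature_dist2 X X' w <= 4.
Proof.
move=> n10 n20; rewrite feature_dist2E//.
have p1 : 0 < n1%:R :> R by rewrite ltr0n.
have p2 : 0 < n2%:R :> R by rewrite ltr0n.
set S1 := \sum_(i < n1) \sum_(j < n1) _.
set S2 := \sum_(i < n2) \sum_(j < n2) _.
set S3 := \sum_(i < n1) \sum_(j < n2) _.
have e1 : S1 / n1%:R ^+ 2 <= 1.
  rewrite ler_pdivrMr ?exprn_gt0// mul1r expr2.
  exact: le_trans (ler_norm _) (norm_sum_cos_le _).
have e2 : S2 / n2%:R ^+ 2 <= 1.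
  rewrite ler_pdivrMr ?exprn_gt0// mul1r expr2.
  exact: le_trans (ler_norm _) (norm_sum_cos_le _).
have e3 : - (S3 / (n1%:R * n2%:R)) <= 1.
  rewrite -mulNr ler_pdivrMr ?mulr_gt0// mul1r.
  by apply: le_trans (ler_norm _) _; rewrite normrN; exact: norm_sum_cos_le.
by rewrite -mulrA; lra.
Qed.

(** Factoring out exp (- b) <= 1 leaves |exp (b - a) - 1|, which is controlled by exp |a - b| < 1 +
    e. *)
Lemma expR_dist_lt (a b c e : R) : 0 <= b -> 0 < e -> `|a - b| < ln (1 + e) ->
  `|expR (- a) - expR (- b)| < e.
Proof.
move=> b0 e0 ab.
have ee : expR `|a - b| < 1 + e by rewrite -(@lnK _ (1 + e)) ?ltr_expR// posrE; lra.
have -> : expR (- a) = expR (- b) * expR (b - a).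
  by rewrite -expRD; congr expR; ring.
have b1 : expR (- b) <= 1 by rewrite -[leRHS]expR0 ler_expR oppr_le0.
rewrite -[X in _ - X]mulr1 -mulrBr normrM ger0_norm ?expR_ge0//.
apply: (@le_lt_trans _ _ `|expR (b - a) - 1|); first by rewrite ler_piMl.
rewrite ltr_norml; apply/andP; split.
  (* Lower side: exp (b - a) > 1 / (1 + e) > 1 - e. *)
  have := expR_gt0 (b - a).
  have : expR (b - a) * expR (a - b) = 1 by rewrite -expRD -[RHS]expR0; congr expR; ring.
  have : expR (a - b) < 1 + e by rewrite (le_lt_trans _ ee)// ler_expR ler_norm.
  by nra.
rewrite ltrBlDl (le_lt_trans _ ee)// ler_expR.
by rewrite distrC ler_norm.
Qed.
End random_features.

(** * Linear combinations of integrable variables *)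

Section has_mean.
Context d (T : measurableType d) (R : realType) (P : probability T R).
Implicit Types (f g : T -> R) (v c : R).

(** Integrability is bundled with the value of the integral so that both pass through linear
    combinations together. *)
Definition has_mean f v :=
  P.-integrable setT (EFin \o f) /\ (\int[P]_w (f w)%:E = v%:E)%E.

Lemma has_meanD f g v v' : has_mean f v -> has_mean g v' ->
  has_mean (fun w => f w + g w) (v + v').
Proof.
move=> [fi fE] [gi gE]; split.
  rewrite (_ : _ \o _ = (EFin \o f) \+ (EFin \o g))%E//; exact: integrableD.
by under eq_integral do rewrite EFinD; rewrite integralD// fE gE.
Qed.

Lemma has_meanZ f v c : has_mean f v -> has_mean (fun w => c * f w) (c * v).
Proof.
move=> [fi fE]; split; first exact: (integrableZl measurableT c fi).
by under eq_integral do rewrite EFinM; rewrite (integralZl measurableT fi) fE.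
Qed.

Lemma has_mean_cst c : has_mean (fun=> c) c.
Proof.
split; first by apply: (integrable_bounded P (M := `|c|)).
by rewrite integral_cst//= probability_setT mule1.
Qed.

Lemma has_mean_sum n (f : 'I_n -> T -> R) (v : 'I_n -> R) :
  (forall i, has_mean (f i) (v i)) ->
  has_mean (fun w => \sum_(i < n) f i w) (\sum_(i < n) v i).
Proof.
move=> fv; elim: (index_enum _) => [|i r IH].
  rewrite big_nil (_ : (fun w => _) = fun=> 0); first exact: has_mean_cst.
  by apply/funext => w; rewrite big_nil.
rewrite big_cons (_ : (fun w => _) = fun w => f i w + \sum_(j <- r) f j w).
  exact: has_meanD.
by apply/funext => w; rewrite big_cons.
Qed.

Lemma has_mean_ext f g v : f =1 g -> has_mean f v -> has_mean g v.
Proof. by move=> /funext ->. Qed.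

End has_mean.

(** * Gaussian kernels and the squared MMD as means of features *)

Section gaussian_vector.
Context d (T : measurableType d) (R : realType) (P : probability T R).
Context (I : finType) (X : I -> T -> R) (mX : forall i, measurable_fun setT (X i)).
Hypothesis indepX : mutually_independent P X.
Variables (n : nat) (iota : 'I_n -> I) (s : R).
Hypotheses (iota_inj : injective iota) (s0 : 0 < s).
Hypothesis lawX : forall k B, measurable B -> P (X (iota k) @^-1` B) = normal_prob 0 s B.

(** The characteristic function at [c] of one feature vector, which [iota] selects inside the whole
    family; it is [integral_cos_sum] with zero phase. *)
Lemma has_mean_cos_linear (c : 'I_n -> R) :
  has_mean P (fun w => cos (\sum_(k < n) c k * X (iota k) w))
    (expR (- (s ^+ 2 * \sum_(k < n) c k ^+ 2) / 2)).
Proof.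
(* The coefficients are carried along [iota] and extended by 0 outside its image. *)
pose a i := if [pick k | iota k == i] is Some k then c k else 0.
have aE k : a (iota k) = c k.
  rewrite /a; case: pickP => [k' /eqP/iota_inj -> //|/(_ k)].
  by rewrite eqxx.
pose r := [seq iota k | k <- index_enum 'I_n].
have ur : uniq r by rewrite map_inj_uniq ?index_enum_uniq.
have lawr i : i \in r -> forall B, measurable B -> P (X i @^-1` B) = normal_prob 0 s B.
  by move=> /mapP[k _ ->]; exact: lawX.
have := integral_cos_sum mX indepX a 0 s0 ur lawr.
rewrite cos0 mul1r big_map.
under eq_bigr do rewrite aE.
move=> E; split; last first.
  rewrite -E; apply: eq_integral => w _; rewrite addr0 big_map.
  by under [in RHS]eq_bigr do rewrite aE.
apply: (integrable_bounded P (M := 1)) => [|w]; last exact: cos_max.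
apply: (measurableT_comp (continuous_measurable_fun (@continuous_cos R))).
apply: measurable_sum_in => k _; exact: measurable_funM.
Qed.

(** Each cosine of a difference has as mean a Gaussian kernel whose bandwidth is the inverse of the
    standard deviation of the features; linearity does the rest. *)
Lemma has_mean_feature_dist2 n1 n2 (Y : 'I_n1 -> 'I_n -> R) (Y' : 'I_n2 -> 'I_n -> R) :
  (0 < n1)%N -> (0 < n2)%N ->
  has_mean P (fun w => feature_dist2 Y Y' (fun k => X (iota k) w))
    (mmd2 s^-1 Y Y').
Proof.
move=> n10 n20.
have cosE (a b : 'I_n -> R) : has_mean P
    (fun w => cos (dotv (fun k => X (iota k) w) a - dotv (fun k => X (iota k) w) b))
    (gauss_kernel s^-1 a b).
  have := has_mean_cos_linear (fun k => a k - b k).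
  rewrite (_ : expR _ = gauss_kernel s^-1 a b); last first.
    rewrite /gauss_kernel; congr expR.
    rewrite /sqdist /dotv (eq_bigr (fun k => (a k - b k) ^+ 2))//.
    by field; exact: lt0r_neq0.
  by apply: has_mean_ext => w; rewrite dotvBr.
have sumE m1 m2 (U : 'I_m1 -> 'I_n -> R) (U' : 'I_m2 -> 'I_n -> R) : has_mean P
    (fun w => \sum_(i < m1) \sum_(j < m2)
       cos (dotv (fun k => X (iota k) w) (U i) - dotv (fun k => X (iota k) w) (U' j)))
    (\sum_(i < m1) \sum_(j < m2) gauss_kernel s^-1 (U i) (U' j)).
  by apply: has_mean_sum => i; apply: has_mean_sum => j; exact: cosE.
have := has_meanD (has_meanD (has_meanZ (n1%:R ^- 2) (sumE _ _ Y Y))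
    (has_meanZ (n2%:R ^- 2) (sumE _ _ Y' Y')))
  (has_meanZ (- 2 / (n1%:R * n2%:R)) (sumE _ _ Y Y')).
rewrite (_ : _ + _ = mmd2 s^-1 Y Y'); last by rewrite /mmd2; ring.
by apply: has_mean_ext => w; rewrite feature_dist2E//; ring.
Qed.

End gaussian_vector.

(** Here [M] stands for the squared MMD, [A] for its random approximation and [c] for the kernel
    factor on x, which can only shrink the distance. *)
Lemma kbar_dist_lt (R : realType) (A M sP c e : R) : 0 < sP -> 0 <= A ->
  0 <= c <= 1 -> 0 < e -> `|A - M| < 2 * sP ^+ 2 * ln (1 + e) ->
  `|expR (- M / (2 * sP ^+ 2)) * c - expR (- A / (2 * sP ^+ 2)) * c| < e.
Proof.
move=> sP0 A0 /andP[c0 c1] e0 AM.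
have p0 : 0 < 2 * sP ^+ 2 by rewrite mulr_gt0// exprn_gt0.
rewrite -mulrBl normrM (ger0_norm c0).
apply: (@le_lt_trans _ _ `|expR (- M / (2 * sP ^+ 2)) - expR (- A / (2 * sP ^+ 2))|).
  by rewrite ler_piMr.
rewrite !mulNr; apply: expR_dist_lt => //; first by rewrite divr_ge0// ltW.
rewrite -mulrBl normrM (gtr0_norm (_ : 0 < (2 * sP ^+ 2)^-1)) ?invr_gt0//.
by rewrite ltr_pdivrMr// distrC mulrC.
Qed.

(** The crossed weights in [uvec] are designed for this: dividing sX^2 |Z_P - Z_P'|^2 + sP^2 |x -
    x'|^2 by 2 (sP sX)^2 gives each term its own bandwidth. *)
Lemma uvec_kernelE (R : realType) d L n1 n2 (sP sX : R) (W : 'I_L -> 'I_d -> R)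
    (X : 'I_n1 -> 'I_d -> R) (X' : 'I_n2 -> 'I_d -> R) (x x' : 'I_d -> R) :
  0 < sP -> 0 < sX ->
  expR (- ((sP * sX)^-1 ^+ 2 *
     \sum_(j < 2 * L + d) (uvec sP sX W X x j - uvec sP sX W X' x' j) ^+ 2) / 2)
  = expR (- ((\sum_(l < L) feature_dist2 X X' (W l)) / L%:R) / (2 * sP ^+ 2))
    * expR (- sqdist x x' / (2 * sX ^+ 2)).
Proof.
move=> sP0 sX0; rewrite -expRD; congr expR.
rewrite (_ : \sum_(j < _) _ = sqdist (uvec sP sX W X x) (uvec sP sX W X' x')).
  rewrite sqdist_uvec sqdist_ZP; set A := _ / L%:R; field.
  by rewrite !lt0r_neq0.
by [].
Qed.

(** * Deviation of the two feature layers *)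

Section random_feature_approximation.
Variables (R : realType) (d n1 n2 L Q : nat) (s' sP sX : R)
    (X : 'I_n1 -> 'I_d -> R) (X' : 'I_n2 -> 'I_d -> R) (x x' : 'I_d -> R)
    (dT : measure_display) (T : measurableType dT) (P : probability T R)
    (W : 'I_L -> 'I_d -> {RV P >-> R})
    (V : 'I_Q -> 'I_(2 * L + d) -> {RV P >-> R}).
Hypotheses (n10 : (0 < n1)%N) (n20 : (0 < n2)%N).
Hypotheses (s'0 : 0 < s') (sP0 : 0 < sP) (sX0 : 0 < sX).
Let F := feature_family W V.
Hypothesis indepF : mutually_independent P F.
Hypothesis lawW : forall l k B, measurable B -> P (W l k @^-1` B) = normal_prob 0 s'^-1 B.
Hypothesis lawV : forall q j B, measurable B ->
  P (V q j @^-1` B) = normal_prob 0 (sP * sX)^-1 B.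
Let I : finType := ('I_L * 'I_d + 'I_Q * 'I_(2 * L + d))%type.
Let Wt t l k := W l k t.
Let Vt t q j := V q j t.

Let mF i : measurable_fun setT (F i).
Proof. by case: i => -[? ?]; exact: measurable_funP. Qed.

Let avg_dist t := (\sum_(l < L) feature_dist2 X X' (Wt t l)) / L%:R.

Let JL l : {set I} := [set i | if i is inl p then p.1 == l else false]%SET.

Let mfd l : measurable_fun setT
  ((fun t => feature_dist2 X X' (Wt t l)) : family_type F (JL l) -> R).
Proof.
have mW k : measurable_fun setT (W l k : family_type F (JL l) -> R).
  by apply: (@measurable_family_coord _ _ _ _ F (JL l) (inl (l, k))); rewrite inE/=.
have mdot a : measurable_fun setT ((fun t => dotv (Wt t l) a) : family_type F (JL l) -> R).
  apply: measurable_sum_in => k _; apply: measurable_funM => //; exact: mW.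
have mtrig (h : R -> R) n (Z : 'I_n -> 'I_d -> R) : continuous h ->
    measurable_fun setT ((fun t => (\sum_(i < n) h (dotv (Wt t l) (Z i))) / n%:R)
      : family_type F (JL l) -> R).
  move=> ch; apply: measurable_funM => //; apply: measurable_sum_in => i _.
  exact: (measurableT_comp (continuous_measurable_fun ch) (mdot (Z i))).
apply: measurable_funD; apply: measurable_funX; apply: measurable_funB;
  apply: mtrig; [exact: continuous_cos|exact: continuous_cos
    |exact: continuous_sin|exact: continuous_sin].
Qed.

Let mavg : measurable_fun setT avg_dist.
Proof.
apply: measurable_funM => //; apply: measurable_sum_in => l _.
exact: (measurable_family mF (@mfd l)).
Qed.

Lemma avg_feature_dist2_deviation e : (0 < L)%N -> 0 < e ->
  (P [set t | (2 * e <= `|avg_dist t - mmd2 s' X X'|)%R]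
    <= (2 * expR (- (L%:R * e ^+ 2) / 2))%:E)%E.
Proof.
move=> L0 e0.
(* The affine map from [0, 4] onto [-1, 1] halves deviations, hence the threshold 2 e in the
   statement. *)
pose Y l t := 2^-1 * feature_dist2 X X' (Wt t l) - 1.
have dJ l l' : l != l' -> [disjoint JL l & JL l']%B.
  move=> ll'; apply/pred0P => -[[l0 k0]|p] /=; rewrite !inE//=.
  by case: eqP => //= ->; apply/negbTE.
have mY l : measurable_fun setT (Y l : family_type F (JL l) -> R).
  by apply: measurable_funB => //; apply: measurable_funM => //; exact: mfd.
have Y1 l t : `|Y l t| <= 1.
  have := feature_dist2_ge0 X X' (Wt t l).
  have := feature_dist2_le4 X X' (Wt t l) n10 n20.
  by rewrite /Y ler_norml => ? ?; apply/andP; split; lra.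
have EY l : (\int[P]_t (Y l t)%:E = (2^-1 * mmd2 s' X X' - 1)%:E)%E.
  have iota_inj : injective (fun k : 'I_d => inl (l, k) : I) by move=> k k' [].
  have s'V0 : 0 < s'^-1 by rewrite invr_gt0.
  have := has_mean_feature_dist2 mF indepF iota_inj s'V0 (lawW l) X X' n10 n20.
  rewrite invrK => /(has_meanZ 2^-1) hm.
  by have [_] := has_meanD hm (has_mean_cst P (- 1)).
apply: le_trans (hoeffding mF indepF L0 e0 dJ mY Y1 EY).
rewrite le_eqVlt; apply/orP; left; apply/eqP; congr (P _); apply/seteqP.
have L0R : L%:R != 0 :> R by rewrite pnatr_eq0 -lt0n.
have YE t : (\sum_(l < L) Y l t) / L%:R - (2^-1 * mmd2 s' X X' - 1)
    = 2^-1 * (avg_dist t - mmd2 s' X X').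
  by rewrite /Y /avg_dist sumrB -mulr_sumr sumr_const card_ord; field.
have nE t : (e <= `|2^-1 * (avg_dist t - mmd2 s' X X')|) =
    (2 * e <= `|avg_dist t - mmd2 s' X X'|).
  by rewrite normrM ger0_norm// ler_pdivlMl.
by split => t /=; rewrite YE nE.
Qed.

Let delta t j := uvec sP sX (Wt t) X x j - uvec sP sX (Wt t) X' x' j.
Let ktilde t :=
  expR (- ((sP * sX)^-1 ^+ 2 * \sum_(j < 2 * L + d) delta t j ^+ 2) / 2).
Let JW : {set I} := [set i | if i is inl _ then true else false]%SET.
Let JV : {set I} := [set i | if i is inr _ then true else false]%SET.
(** The product zbar^T zbar' with first-layer features read at [z.1] and second-layer features at
    [z.2]; the actual estimator is its restriction to the diagonal. *)
Let G (z : family_type F JW * family_type F JV) :=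
  (\sum_(q < Q) cos (\sum_(j < 2 * L + d) delta z.1 j * Vt z.2 q j)) / Q%:R.

Let dJ : [disjoint JW & JV]%B.
Proof. by apply/pred0P => -[p|p] /=; rewrite !inE. Qed.

Let mdelta j : measurable_fun setT (delta^~ j : family_type F JW -> R).
Proof.
have mW l k : measurable_fun setT ((fun t => Wt t l k) : family_type F JW -> R).
  by apply: (@measurable_family_coord _ _ _ _ F JW (inl (l, k))); rewrite inE.
have mu n (Y : 'I_n -> 'I_d -> R) (y : 'I_d -> R) :
    measurable_fun setT ((fun t => uvec sP sX (Wt t) Y y j) : family_type F JW -> R).
  rewrite /uvec; case: fintype.split => k; last exact: measurable_cst.
  apply: measurable_funM => //; apply: measurable_funM => //.
  apply: measurable_sum_in => i _.
  have mdot : measurable_fun setT ((fun t => dotv (Wt t (half_ord k)) (Y i))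
      : family_type F JW -> R).
    apply: measurable_sum_in => k' _; apply: measurable_funM => //; exact: mW.
  rewrite /cos_sin; case: (odd k).
    exact: (measurableT_comp (continuous_measurable_fun (@continuous_sin R)) mdot).
  exact: (measurableT_comp (continuous_measurable_fun (@continuous_cos R)) mdot).
by apply: measurable_funB; exact: mu.
Qed.

Let mktilde : measurable_fun setT (ktilde : family_type F JW -> R).
Proof.
apply: (measurableT_comp (@measurable_expR R)); apply: measurable_funM => //.
apply: measurable_funN; apply: measurable_funM => //.
by apply: measurable_sum_in => j _; exact: measurable_funX.
Qed.

Let mG : measurable_fun setT G.
Proof.
apply: measurable_funM => //; apply: measurable_sum_in => q _.
apply: (measurableT_comp (continuous_measurable_fun (@continuous_cos R))).
apply: measurable_sum_in => j _; apply: measurable_funM.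
  exact: (measurableT_comp (mdelta j) measurable_fst).
have mV : measurable_fun setT ((fun t => Vt t q j) : family_type F JV -> R).
  by apply: (@measurable_family_coord _ _ _ _ F JV (inr (q, j))); rewrite inE.
exact: (measurableT_comp mV measurable_snd).
Qed.

Let mGdiag : measurable_fun setT (fun t : T => G (t, t)).
Proof.
apply: (measurableT_comp mG); apply: measurable_fun_pair.
  exact: (@measurable_fun_family_id _ _ _ _ _ mF JW).
exact: (@measurable_fun_family_id _ _ _ _ _ mF JV).
Qed.

Let mGk e : measurable [set z | (e <= `|G z - ktilde z.1|)%R].
Proof.
rewrite -[X in measurable X]setTI; apply: measurable_fun_le => //.
apply: measurableT_comp => //; apply: measurable_funB => //.
exact: (measurableT_comp mktilde measurable_fst).
Qed.

(** Decoupling freezes the first layer at [t]. The [Y q] are then cosines of linear forms in v_q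
    with constant coefficients, all of mean [ktilde t]. *)
Lemma second_layer_deviation e : (0 < Q)%N -> 0 < e ->
  (P [set t | (e <= `|G (t, t) - ktilde t|)%R]
    <= (2 * expR (- (Q%:R * e ^+ 2) / 2))%:E)%E.
Proof.
move=> Q0 e0; apply: (family_probability_pair_le mF indepF dJ (mGk e)) => t.
pose J q : {set I} := [set i | if i is inr p then p.1 == q else false]%SET.
pose Y q t' := cos (\sum_(j < 2 * L + d) delta t j * V q j t').
have dJ' q q' : q != q' -> [disjoint J q & J q']%B.
  move=> qq'; apply/pred0P => -[p|[q0 k0]] /=; rewrite !inE//=.
  by case: eqP => //= ->; apply/negbTE.
have mY q : measurable_fun setT (Y q : family_type F (J q) -> R).
  apply: (measurableT_comp (continuous_measurable_fun (@continuous_cos R))).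
  apply: measurable_sum_in => j _; apply: measurable_funM => //.
  by apply: (@measurable_family_coord _ _ _ _ F (J q) (inr (q, j))); rewrite inE/=.
have Y1 q t' : `|Y q t'| <= 1 by exact: cos_max.
have EY q : (\int[P]_t' (Y q t')%:E = (ktilde t)%:E)%E.
  have iota_inj : injective (fun j : 'I_(2 * L + d) => inr (q, j) : I) by move=> j j' [].
  have s0 : 0 < (sP * sX)^-1 by rewrite invr_gt0 mulr_gt0.
  by have [] := has_mean_cos_linear mF indepF iota_inj s0 (lawV q) (delta t).
exact: (hoeffding mF indepF Q0 e0 dJ' mY Y1 EY).
Qed.

(** Outside the deviation events of the two layers, the triangle inequality through [ktilde] keeps
    the error below eps_l + eps_q. *)
Lemma approximation_error_bound eps_l eps_q : 0 < eps_l -> 0 < eps_q ->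
  (P [set t | (eps_l + eps_q <=
        `| kbar s' sP sX X X' x x'
           - dotv (zbar (Vt t) (uvec sP sX (Wt t) X x))
                  (zbar (Vt t) (uvec sP sX (Wt t) X' x')) |)%R]
   <= (2 * expR (- (Q%:R * eps_q ^+ 2) / 2)
       + 6 * n1%:R * n2%:R * expR (- (L%:R * (sP ^+ 2 / 2 * ln (1 + eps_l)) ^+ 2) / 2))%:E)%E.
Proof.
move=> el0 eq0; set eps := sP ^+ 2 / 2 * _.
have lnel : 0 < ln (1 + eps_l) by rewrite ln_gt0// ltrDl.
have eps0 : 0 < eps by rewrite /eps mulr_gt0// divr_gt0// exprn_gt0.
under eq_set do rewrite dotv_zbar -/(G (_, _)).
set E := [set t | _].
have mE : measurable E.
  rewrite -[X in measurable X]setTI; apply: measurable_fun_le => //.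
  by apply: measurableT_comp => //; exact: measurable_funB.
have n12 : 1 <= n1%:R * n2%:R :> R by rewrite -natrM ler1n muln_gt0 n10.
(* Hoeffding's inequality needs L and Q positive; if either is 0, the right-hand side is at least
   1. *)
have [L0|L0] := posnP L.
  apply: (le_trans (probability_le1 P mE)); rewrite lee_fin.
  have := expR_ge0 (- (Q%:R * eps_q ^+ 2) / 2).
  by rewrite L0 mul0r oppr0 mul0r expR0 -mulrA; lra.
have [Q0|Q0] := posnP Q.
  apply: (le_trans (probability_le1 P mE)); rewrite lee_fin.
  rewrite Q0 mul0r oppr0 mul0r expR0.
  have : 0 <= 6 * n1%:R * n2%:R * expR (- (L%:R * eps ^+ 2) / 2).
    by rewrite mulr_ge0 ?expR_ge0// -mulrA; lra.
  by lra.
pose A := [set t | 2 * eps <= `|avg_dist t - mmd2 s' X X'|].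
pose B := [set t : T | eps_q <= `|G (t, t) - ktilde t|].
have mA : measurable A.
  rewrite -[X in measurable X]setTI; apply: measurable_fun_le => //.
  by apply: measurableT_comp => //; exact: measurable_funB.
have mB : measurable B.
  rewrite -[X in measurable X]setTI; apply: measurable_fun_le => //.
  apply: measurableT_comp => //; apply: measurable_funB => //.
  exact: (measurable_family mF mktilde).
have EAB : E `<=` A `|` B.
  move=> t Et; case: (leP (2 * eps) `|avg_dist t - mmd2 s' X X'|) => [|lt_eps].
    by left.
  right; rewrite /B /=.
  have c01 : 0 <= expR (- sqdist x x' / (2 * sX ^+ 2)) <= 1.
    rewrite expR_ge0 /= -[leRHS]expR0 ler_expR mulNr oppr_le0 divr_ge0//.
      by apply: sumr_ge0 => j _; rewrite -expr2 sqr_ge0.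
    by rewrite mulr_ge0// sqr_ge0.
  have avg0 : 0 <= avg_dist t.
    by rewrite divr_ge0// sumr_ge0// => l _; exact: feature_dist2_ge0.
  (* 2 eps equals sP^2 ln (1 + eps_l), half of what [kbar_dist_lt] allows. *)
  have lt2 : `|avg_dist t - mmd2 s' X X'| < 2 * sP ^+ 2 * ln (1 + eps_l).
    apply: (lt_le_trans lt_eps); rewrite /eps.
    have := mulr_gt0 (exprn_gt0 2 sP0) lnel; lra.
  have := kbar_dist_lt sP0 avg0 c01 el0 lt2.
  rewrite -[expR (- avg_dist t / _) * _]uvec_kernelE// -/(ktilde t) => lt_el.
  have := le_trans Et (ler_distD (ktilde t) _ _).
  by rewrite (distrC (ktilde t)) /kbar; lra.
apply: (@le_trans _ _ (P (A `|` B))).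
  by apply: le_measure; rewrite ?inE//; exact: measurableU.
apply: (le_trans (measureU2 _ mA mB)).
rewrite EFinD addeC; apply: leeD; last exact: second_layer_deviation.
apply: (le_trans (avg_feature_dist2_deviation L0 eps0)).
(* The constant 2 from Hoeffding's inequality is at most 6 n1 n2. *)
by rewrite lee_fin ler_pM2r ?expR_gt0// -mulrA; lra.
Qed.

End random_feature_approximation.

Unset Implicit Arguments.

Theorem theorem6p2 (R : realType) (d n1 n2 L Q : nat) (s' sP sX : R)
    (X : 'I_n1 -> 'I_d -> R) (X' : 'I_n2 -> 'I_d -> R) (x x' : 'I_d -> R)
    (dT : measure_display) (T : measurableType dT) (P : probability T R)
    (W : 'I_L -> 'I_d -> {RV P >-> R})
    (V : 'I_Q -> 'I_(2 * L + d) -> {RV P >-> R})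
    (eps_l eps_q : R) :
  (0 < n1)%N -> (0 < n2)%N ->
  0 < s' -> 0 < sP -> 0 < sX ->
  mutually_independent P (feature_family W V) ->
  (forall l k B, measurable B -> P (W l k @^-1` B) = normal_prob 0 s'^-1 B) ->
  (forall q j B, measurable B ->
     P (V q j @^-1` B) = normal_prob 0 (sP * sX)^-1 B) ->
  0 < eps_l -> 0 < eps_q ->
  let Wt := fun t l k => W l k t in
  let Vt := fun t q j => V q j t in
  let eps := sP ^+ 2 / 2 * ln (1 + eps_l) in
  (P [set t | (eps_l + eps_q <=
        `| kbar s' sP sX X X' x x'
           - dotv (zbar (Vt t) (uvec sP sX (Wt t) X x))
                  (zbar (Vt t) (uvec sP sX (Wt t) X' x')) |)%R]
   <= (2 * expR (- (Q%:R * eps_q ^+ 2) / 2)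
       + 6 * n1%:R * n2%:R * expR (- (L%:R * eps ^+ 2) / 2))%:E)%E.
Proof.
move=> n10 n20 s'0 sP0 sX0 indepF lawW lawV el0 eq0.
exact: approximation_error_bound.
Qed.
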